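(* Let $f$ be an admissible integrand. The physical limit ${}_0\phi_s=\lim_{z\to0}{}_z\phi_{R,s}$ of the toy model exists and maps $H_R$ into the polynomials $\mathbb{C}[\ln\frac s\mu]$. That is, for every $g\in H_R$ and all $s,\mu>0$ the limit ${}_0\phi_s(g)=\lim_{z\to0}{}_z\phi_{R,s}(g)$ exists, and there is a polynomial $p_g\in\mathbb{C}[x]$ with ${}_0\phi_s(g)=p_g(\ln\frac s\mu)$.
   Context: $H_R$: a rooted tree is an isomorphism class of finite (nonempty, unordered) rooted trees; $\mathcal{F}$ is the set of rooted forests, i.e. finite multisets of rooted trees, including the empty forest $\mathbf 1$. $H_R$ (here over $\mathbb{C}$) is the free commutative algebra on rooted trees, with basis $\mathcal{F}$ and product disjoint union. $B_+$ is the linear map sending a forest to the tree obtained by joining all its roots to a new root. $H_R$ is a Hopf algebra with $\Delta$ the unital algebra morphism determined by $\Delta\circ B_+=B_+\otimes\mathbf 1+(\mathrm{id}\otimes B_+)\circ\Delta$, counit $\varepsilon(\mathbf 1)=1$, $\varepsilon(g)=0$ for forests $g\ne\mathbf 1$, and antipode $S$. Convolution: $\phi\star\psi=m\circ(\phi\otimes\psi)\circ\Delta$. Toy model: an admissible integrand is a measurable function $f:(0,\infty)\to\mathbb{C}$ with $f(\zeta)=O(\zeta^{-1})$ as $\zeta\to\infty$, such that for some $\delta>0$ the integral $F(z)=\int_0^\infty f(\zeta)\zeta^{-z}\,d\zeta$ converges absolutely for $0<\mathrm{Re}\,z<\delta$ and $F$ extends to a meromorphic function near $z=0$ with a pole of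 first order at $z=0$, $F(z)=\sum_{n=-1}^\infty c_nz^n$. (The original model is $f(\zeta)=\frac1{1+\zeta}$.) The regularized Feynman rules ${}_z\phi$ form the morphism of unital algebras from $H_R$ to functions of $s>0$ and $z$ determined by $${}_z\phi_s(B_+(g))=\int_0^\infty (s\zeta)^{-z}f(\zeta)\;{}_z\phi_{s\zeta}(g)\,d\zeta ,$$ for $\mathrm{Re}\,z>0$ sufficiently small (depending on $g$), and extended meromorphically to a neighbourhood of $z=0$ (depending on $g$). For a subtraction point $\mu>0$ (momentum scheme), the counterterms are $Z={}_z\phi_\mu\circ S$ and the renormalized Feynman rules are ${}_z\phi_{R,s}=Z\star{}_z\phi_s$. *)

(* Defs.v *)
From HB Require Import structures.
From mathcomp Require Import all_boot all_order all_algebra.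
From mathcomp Require Import finmap.
From mathcomp.multinomials Require Import monalg.
From mathcomp Require Import complex.
From mathcomp Require Import all_classical all_reals all_analysis.

Set Implicit Arguments.
Unset Strict Implicit.
Unset Printing Implicit Defensive.

Import Order.TTheory GRing.Theory Num.Theory numFieldNormedType.Exports.

Local Open Scope ring_scope.

Inductive ptree := PNode of seq ptree.

Definition pchildren (t : ptree) := let: PNode l := t in l.

Fixpoint ptree_encode (t : ptree) : GenTree.tree unit :=
  let: PNode l := t in GenTree.Node 0 (map ptree_encode l).

Fixpoint ptree_decode (t : GenTree.tree unit) : ptree :=
  if t is GenTree.Node _ l then PNode (map ptree_decode l) else PNode [::].

Lemma ptree_ind_seq (P : ptree -> Prop) :
  (forall l, (forall i, (i < size l)%N -> P (nth (PNode [::]) l i)) ->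
     P (PNode l)) ->
  forall t, P t.
Proof.
move=> IH; fix rec 1 => -[l]; apply: IH.
elim: l => [|u l IHl]; first by clear rec => i; rewrite ltn0.
case=> [_|i]; first exact: (rec u).
by clear rec; exact: IHl.
Qed.

Lemma ptree_encodeK : cancel ptree_encode ptree_decode.
Proof.
elim/ptree_ind_seq => l IH /=; congr PNode.
rewrite -map_comp; apply: (@eq_from_nth _ (PNode [::])); rewrite size_map //.
by move=> i hi; rewrite (nth_map (PNode [::])) //= IH.
Qed.

HB.instance Definition _ := Countable.copy ptree (can_type ptree_encodeK).

Lemma ptree_ind_in (P : ptree -> Prop) :
  (forall l, (forall u, u \in l -> P u) -> P (PNode l)) -> forall t, P t.
Proof.
move=> IH; elim/ptree_ind_seq => l IHl; apply: IH => u ul.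
by have := IHl (index u l); rewrite index_mem nth_index //; exact.
Qed.

Definition ptree_le : rel ptree := relpre choice.pickle leq.

Lemma ptree_le_total : total ptree_le.
Proof. by move=> t u; exact: leq_total. Qed.

Lemma ptree_le_trans : transitive ptree_le.
Proof. by move=> t u v; exact: leq_trans. Qed.

Lemma ptree_le_anti : antisymmetric ptree_le.
Proof. by move=> t u /anti_leq /(pcan_inj choice.pickleK). Qed.

Fixpoint canonical_ptree (t : ptree) : bool :=
  let: PNode l := t in sorted ptree_le l && all canonical_ptree l.

(* Two plane trees are isomorphic as rooted trees exactly when they agree after
   sorting the children of all vertices (for any fixed total order): every
   isomorphism class of rooted trees has exactly one hereditarily sorted plane
   representative, and [=] on [rtree] is isomorphism. *)
Record rtree := RTree { ptree_of : ptree; _ : canonical_ptree ptree_of }.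

HB.instance Definition _ := [isSub for ptree_of].
HB.instance Definition _ := [Countable of rtree by <:].

(* A forest is a finite multiset of trees: m t is the multiplicity of t, and
   the empty forest and the disjoint union are the unit and the product of the
   commutative monoid. *)
Notation forest := {cmonom rtree}.

Definition forest_seq (m : forest) : seq rtree :=
  flatten [seq nseq (m t) t | t <- finsupp m].

Definition forest_node (m : forest) : ptree :=
  PNode (sort ptree_le (map val (forest_seq m))).

Lemma canonical_forest_node (m : forest) : canonical_ptree (forest_node m).
Proof.
rewrite /= sort_sorted ?all_sort /=; last exact: ptree_le_total.
by apply/allP => _ /mapP[t _ ->]; exact: (valP t).
Qed.

Definition graft (m : forest) : rtree := RTree (canonical_forest_node m).

Definition branches (t : rtree) : seq rtree := pmap insub (pchildren (val t)).

Definition seq_forest (s : seq rtree) : forest := \big[mmul/mone]_(t <- s) ucm t.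

Lemma seq_forestE s t : seq_forest s t = count_mem t s.
Proof.
rewrite /seq_forest; elim: s => [|u s IH]; first by rewrite big_nil cm1.
by rewrite big_cons cmM cmU IH.
Qed.

Lemma count_forest_seq (m : forest) t : count_mem t (forest_seq m) = m t.
Proof.
rewrite /forest_seq count_flatten -map_comp.
rewrite (@eq_map _ _ _ (fun u => (u == t) * m u)%N); last first.
  by move=> u /=; rewrite count_nseq.
rewrite sumnE big_map.
have [tm|tm] := boolP (t \in finsupp m).
  rewrite (bigD1_seq t) ?fset_uniq //= eqxx mul1n big1 ?addn0 //.
  by move=> u /negPf ->.
rewrite big1_seq; first by apply/esym/eqP; rewrite cmE_eq0.
move=> u /andP[_ um]; case: eqP => // ut; by rewrite -ut um in tm.
Qed.

Lemma forest_seqK : cancel forest_seq seq_forest.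
Proof. by move=> m; apply/eqP/cmP => t; rewrite seq_forestE count_forest_seq. Qed.

Lemma val_branches (t : rtree) : map val (branches t) = pchildren (val t).
Proof.
rewrite /branches; have := valP t; case: (val t) => l /= /andP[_].
elim: l => //= u l IH /andP[cu cl]; by rewrite insubT /= IH.
Qed.

Lemma seq_forestK (s : seq rtree) : perm_eq (forest_seq (seq_forest s)) s.
Proof. by apply/allP => u _ /=; rewrite count_forest_seq seq_forestE. Qed.

Lemma graft_branches (t : rtree) : graft (seq_forest (branches t)) = t.
Proof.
apply/val_inj; rewrite /= /forest_node.
have := perm_map val (seq_forestK (branches t)); rewrite val_branches.
have : sorted ptree_le (pchildren (val t)) by case: t => -[l] /= c; case/andP: (c).
case: t => -[l] c /= sl ps; congr PNode.
apply: (sorted_eq ptree_le_trans ptree_le_anti) => //.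
  exact: sort_sorted ptree_le_total _.
by rewrite perm_sort.
Qed.

Lemma perm_branches_graft (m : forest) :
  perm_eq (branches (graft m)) (forest_seq m).
Proof.
apply: (perm_map_inj (@val_inj _ _ rtree)).
by rewrite val_branches /= perm_sort.
Qed.

Lemma rtree_graft_ind (P : rtree -> Prop) :
  (forall m : forest, (forall t, t \in finsupp m -> P t) -> P (graft m)) ->
  forall t, P t.
Proof.
move=> IH [t ct]; elim/ptree_ind_in: t ct => l IHl ct.
rewrite -[RTree ct]graft_branches; apply: IH => u.
rewrite -cmE_neq0 seq_forestE -lt0n -has_count has_pred1 => ub.
have : val u \in pchildren (val (RTree ct)) by rewrite -val_branches map_f.
case: u ub => u cu _ /= ul; exact: IHl.
Qed.

(* the isomorphism class of a plane tree *)
Fixpoint rtree_of (t : ptree) : rtree :=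
  let: PNode l := t in graft (seq_forest (map rtree_of l)).

Lemma forest_seqM (m1 m2 : forest) :
  perm_eq (forest_seq (mmul m1 m2)) (forest_seq m1 ++ forest_seq m2).
Proof.
by apply/allP => u _ /=; rewrite count_cat !count_forest_seq cmM.
Qed.

Lemma forest_seq1 : forest_seq mone = [::].
Proof. by rewrite /forest_seq mdom1. Qed.

Lemma forest_seqU t : forest_seq (ucm t) = [:: t].
Proof.
apply/perm_small_eq => //; apply/allP => u _ /=.
by rewrite count_forest_seq cmU addn0.
Qed.

Lemma mem_forest_seq (m : forest) t : (t \in forest_seq m) = (t \in finsupp m).
Proof.
by rewrite -cmE_neq0 -count_forest_seq -lt0n -has_count has_pred1.
Qed.

Lemma seq_forest_perm s1 s2 : perm_eq s1 s2 -> seq_forest s1 = seq_forest s2.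
Proof. by move/permP => e; apply/eqP/cmP => t; rewrite !seq_forestE e. Qed.

Lemma val_rtreeK (t : rtree) : rtree_of (val t) = t.
Proof.
elim/rtree_graft_ind: t => m IH /=; congr graft.
rewrite -[RHS]forest_seqK; apply: seq_forest_perm.
have : perm_eq (sort ptree_le (map val (forest_seq m))) (map val (forest_seq m)).
  by rewrite perm_sort.
move/(perm_map rtree_of) => /perm_trans; apply.
rewrite -map_comp (_ : map _ _ = forest_seq m) //.
by apply: map_id_in => t; rewrite mem_forest_seq => /IH.
Qed.

Section BasisLift.
Context {K : comNzRingType} {M : choiceType} {V : lmodType K}.

Definition basis_lift (h : M -> V) (g : {malg K[M]}) : V :=
  \sum_(m <- msupp g) g@_m *: h m.

Lemma basis_liftw h g (d : {fset M}) : (msupp g `<=` d)%fset ->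
  basis_lift h g = \sum_(m <- d) g@_m *: h m.
Proof.
move=> gd; rewrite /basis_lift; apply: (big_fset_incl _ gd) => m _.
by move/mcoeff_outdom => ->; rewrite scale0r.
Qed.

Lemma basis_lift_is_linear h : linear (basis_lift h).
Proof.
move=> a x y; pose d := (msupp (a *: x + y) `|` (msupp x `|` msupp y))%fset.
have sx : (msupp x `<=` d)%fset by rewrite /d fsubsetU // fsubsetUl orbT.
have sy : (msupp y `<=` d)%fset by rewrite /d fsubsetU // fsubsetUr orbT.
have sd : (msupp (a *: x + y) `<=` d)%fset by exact: fsubsetUl.
rewrite (basis_liftw h sx) (basis_liftw h sy) (basis_liftw h sd).
rewrite scaler_sumr -big_split /=; apply: eq_bigr => m _.
by rewrite mcoeffD mcoeffZ scalerDl scalerA.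
Qed.

HB.instance Definition _ h :=
  GRing.isLinear.Build K {malg K[M]} V _ (basis_lift h) (basis_lift_is_linear h).

Lemma basis_liftU h m : basis_lift h << m >> = h m.
Proof. by rewrite /basis_lift msuppU oner_eq0 big_seq_fset1 mcoeffUU scale1r. Qed.

Lemma malg_basisE (g : {malg K[M]}) : g = \sum_(m <- msupp g) g@_m *: << m >>.
Proof.
rewrite {1}[g]monalgE; apply: eq_bigr => m _.
apply/malgP => k; rewrite mcoeffZ !mcoeffU.
by rewrite mulrnAr mulr1.
Qed.

Lemma basis_ext (f1 f2 : {malg K[M]} -> V) : linear f1 -> linear f2 ->
  (forall m, f1 << m >> = f2 << m >>) -> f1 =1 f2.
Proof.
move=> l1 l2 e g.
pose F1 := HB.pack f1 (GRing.isLinear.Build _ _ _ _ f1 l1) : {linear {malg K[M]} -> V}.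
pose F2 := HB.pack f2 (GRing.isLinear.Build _ _ _ _ f2 l2) : {linear {malg K[M]} -> V}.
have : F1 g = F2 g; last by [].
rewrite (malg_basisE g) !linear_sum; apply: eq_bigr => m _.
by rewrite !linearZ /= e.
Qed.

End BasisLift.

Section PairMonomial.
Context {M1 M2 : monomType}.
Implicit Types x y : M1 * M2.

Definition pair_mul x y := (mmul x.1 y.1, mmul x.2 y.2).

Fact pair_mulA : associative pair_mul.
Proof. by move=> x y z; rewrite /pair_mul /= !mulmA. Qed.

Fact pair_mul1m : left_id (mone, mone) pair_mul.
Proof. by case=> a b; rewrite /pair_mul /= !mul1m. Qed.

Fact pair_mulm1 : right_id (mone, mone) pair_mul.
Proof. by case=> a b; rewrite /pair_mul /= !mulm1. Qed.

Fact pair_unitm x y : pair_mul x y = (mone, mone) ->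
  x = (mone, mone) /\ y = (mone, mone).
Proof. by case: x y => [a b] [c d] [/unitm[-> ->] /unitm[-> ->]]. Qed.

HB.instance Definition _ := Choice_isMonomialDef.Build (M1 * M2)%type
  pair_mulA pair_mul1m pair_mulm1 pair_unitm.

End PairMonomial.

Fact pair_mulC (M1 M2 : conomType) : commutative (@pair_mul M1 M2).
Proof. by move=> x y; rewrite /pair_mul mulmC [mmul x.2 _]mulmC. Qed.

HB.instance Definition _ (M1 M2 : conomType) :=
  MonomialDef_isConomialDef.Build (M1 * M2)%type (@pair_mulC M1 M2).

Section BasisLiftM.
Context {K : comNzRingType} {M : conomType} {A : algType K}.

Lemma malgU1E : << mone >> = 1 :> {malg K[M]}.
Proof. by []. Qed.

Lemma malgUM (m1 m2 : M) : << m1 >> * << m2 >> = << mmul m1 m2 >> :> {malg K[M]}.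
Proof. by rewrite malgM_def fgmulUU mulr1. Qed.

Lemma basis_liftM (h : M -> A) : h mone = 1 ->
  {morph h : x y / mmul x y >-> x * y} -> monoid_morphism (basis_lift h).
Proof.
move=> h1 hM; split=> [|x y]; first by rewrite -malgU1E basis_liftU.
rewrite (malg_basisE x) mulr_suml !linear_sum mulr_suml; apply: eq_bigr => m _.
rewrite -scalerAl !linearZ /= -scalerAl; congr (_ *: _).
rewrite (malg_basisE y) mulr_sumr !linear_sum mulr_sumr; apply: eq_bigr => n _.
by rewrite -scalerAr !linearZ /= -scalerAr malgUM !basis_liftU hM.
Qed.

End BasisLiftM.

Section Tensor.
Context {K : comNzRingType}.

Definition tens {M1 M2 : choiceType} (x : {malg K[M1]}) (y : {malg K[M2]}) :
    {malg K[(M1 * M2)%type]} :=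
  basis_lift (fun m1 => basis_lift (fun m2 => << (m1, m2) >>) y) x.

Definition tens_map {M1 M2 N1 N2 : choiceType}
    (f : {malg K[M1]} -> {malg K[N1]}) (g : {malg K[M2]} -> {malg K[N2]}) :
    {malg K[(M1 * M2)%type]} -> {malg K[(N1 * N2)%type]} :=
  basis_lift (fun p => tens (f << p.1 >>) (g << p.2 >>)).

(* multiplication of A after f (x) g *)
Definition tens_mul {M1 M2 : choiceType} {A : algType K}
    (f : {malg K[M1]} -> A) (g : {malg K[M2]} -> A) : {malg K[(M1 * M2)%type]} -> A :=
  basis_lift (fun p => f << p.1 >> * g << p.2 >>).

Lemma tens_linearl {M1 M2 : choiceType} (y : {malg K[M2]}) :
  linear (fun x : {malg K[M1]} => tens x y).
Proof. by move=> a x x'; rewrite /tens linearP. Qed.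

Lemma tens_linearr {M1 M2 : choiceType} (x : {malg K[M1]}) :
  linear (fun y : {malg K[M2]} => tens x y).
Proof.
move=> a y y'; rewrite /tens /basis_lift scaler_sumr -big_split /=.
apply: eq_bigr => m _; rewrite -/(basis_lift _ _) -!/(basis_lift _ _).
by rewrite linearP scalerDr !scalerA mulrC.
Qed.

Lemma tensUU {M1 M2 : choiceType} (m1 : M1) (m2 : M2) :
  tens (<< m1 >> : {malg K[M1]}) << m2 >> = << (m1, m2) >>.
Proof. by rewrite /tens !basis_liftU. Qed.

Lemma tens_map_linear {M1 M2 N1 N2 : choiceType}
    (f : {malg K[M1]} -> {malg K[N1]}) (g : {malg K[M2]} -> {malg K[N2]}) :
  linear (tens_map f g).
Proof. by move=> a x y; rewrite /tens_map linearP. Qed.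

Lemma tens_mapE {M1 M2 N1 N2 : choiceType}
    (f : {malg K[M1]} -> {malg K[N1]}) (g : {malg K[M2]} -> {malg K[N2]}) x y :
  linear f -> linear g -> tens_map f g (tens x y) = tens (f x) (g y).
Proof.
move=> lf lg.
apply: (basis_ext (f1 := fun x => tens_map f g (tens x y))
                  (f2 := fun x => tens (f x) (g y))) => [a u v|a u v|m1].
- by rewrite tens_linearl /tens_map linearP.
- by rewrite lf tens_linearl.
apply: (basis_ext (f1 := fun y => tens_map f g (tens << m1 >> y))
                  (f2 := fun y => tens (f << m1 >>) (g y))) => [a u v|a u v|m2].
- by rewrite tens_linearr /tens_map linearP.
- by rewrite lg tens_linearr.
by rewrite tensUU /tens_map basis_liftU.
Qed.

Lemma tens_mulE {M1 M2 : choiceType} {A : algType K}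
    (f : {malg K[M1]} -> A) (g : {malg K[M2]} -> A) x y :
  linear f -> linear g -> tens_mul f g (tens x y) = f x * g y.
Proof.
move=> lf lg.
apply: (basis_ext (f1 := fun x => tens_mul f g (tens x y))
                  (f2 := fun x => f x * g y)) => [a u v|a u v|m1].
- by rewrite tens_linearl /tens_mul linearP.
- by rewrite lf mulrDl scalerAl.
apply: (basis_ext (f1 := fun y => tens_mul f g (tens << m1 >> y))
                  (f2 := fun y => f << m1 >> * g y)) => [a u v|a u v|m2].
- by rewrite tens_linearr /tens_mul linearP.
- by rewrite lg mulrDr scalerAr.
by rewrite tensUU /tens_mul basis_liftU.
Qed.

Lemma tensM {M1 M2 : conomType} (x x' : {malg K[M1]}) (y y' : {malg K[M2]}) :
  tens (x * x') (y * y') = tens x y * tens x' y'.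
Proof.
apply: (basis_ext (f1 := fun x => tens (x * x') (y * y'))
          (f2 := fun x => tens x y * tens x' y')) => [a u v|a u v|m].
- by rewrite mulrDl -scalerAl tens_linearl.
- by rewrite tens_linearl mulrDl -scalerAl.
apply: (basis_ext (f1 := fun x' => tens (<< m >> * x') (y * y'))
          (f2 := fun x' => tens << m >> y * tens x' y')) => [a u v|a u v|m'].
- by rewrite mulrDr -scalerAr tens_linearl.
- by rewrite tens_linearl mulrDr -scalerAr.
apply: (basis_ext (f1 := fun y => tens (<< m >> * << m' >>) (y * y'))
          (f2 := fun y => tens << m >> y * tens << m' >> y')) => [a u v|a u v|n].
- by rewrite mulrDl -scalerAl tens_linearr.
- by rewrite tens_linearr mulrDl -scalerAl.
apply: (basis_ext (f1 := fun y' => tens (<< m >> * << m' >>) (<< n >> * y'))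
    (f2 := fun y' => tens << m >> << n >> * tens << m' >> y')) => [a u v|a u v|n'].
- by rewrite mulrDr -scalerAr tens_linearr.
- by rewrite tens_linearr mulrDr -scalerAr.
by rewrite !malgUM !tensUU malgUM.
Qed.

Lemma tens11 {M1 M2 : conomType} :
  tens (1 : {malg K[M1]}) (1 : {malg K[M2]}) = 1.
Proof. by rewrite -!malgU1E tensUU. Qed.

Lemma tens_map_morph {M1 M2 N1 N2 : conomType}
    (f : {malg K[M1]} -> {malg K[N1]}) (g : {malg K[M2]} -> {malg K[N2]}) :
  monoid_morphism f -> monoid_morphism g -> monoid_morphism (tens_map f g).
Proof.
move=> [f1 fM] [g1 gM]; apply: basis_liftM => [|p q] /=.
  by rewrite f1 g1 tens11.
by rewrite -!malgUM fM gM tensM.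
Qed.

End Tensor.

Notation HR K := {malg K[forest]}.
(* HR K (x) HR K, with basis the pairs of forests *)
Notation HR2 K := {malg K[(forest * forest)%type]}.

Section HopfAlgebra.
Context {K : comNzRingType}.
Implicit Types (g : HR K) (m : forest) (t : rtree).

Definition tree_elt t : HR K := << ucm t >>.

Definition alg_lift {A : comAlgType K} (h : rtree -> A) : HR K -> A :=
  basis_lift (fun m => \prod_(t <- forest_seq m) h t).

HB.instance Definition _ (A : comAlgType K) (h : rtree -> A) :=
  GRing.Linear.copy (alg_lift h)
    (basis_lift (fun m => \prod_(t <- forest_seq m) h t)).

Lemma alg_lift_morph (A : comAlgType K) (h : rtree -> A) :
  monoid_morphism (alg_lift h).
Proof.
apply: basis_liftM => [|m1 m2]; first by rewrite forest_seq1 big_nil.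
by rewrite (perm_big _ (forest_seqM m1 m2)) big_cat.
Qed.

Lemma alg_liftE (A : comAlgType K) (h : rtree -> A) t :
  alg_lift h (tree_elt t) = h t.
Proof. by rewrite /alg_lift basis_liftU forest_seqU big_seq1. Qed.

Lemma forestE m : << m >> = \prod_(t <- forest_seq m) tree_elt t.
Proof.
rewrite -{1}[m]forest_seqK /seq_forest.
elim: (forest_seq m) => [|t s IH]; first by rewrite !big_nil.
by rewrite !big_cons -IH malgUM.
Qed.

Lemma monoid_morphism_prod (A B : comNzRingType) (f : A -> B) (I : eqType)
    (s : seq I) (F : I -> A) : monoid_morphism f ->
  f (\prod_(i <- s) F i) = \prod_(i <- s) f (F i).
Proof. by case=> f1 fM; rewrite (big_morph f fM f1). Qed.

Lemma alg_ext_forest (A : comAlgType K) (f1 f2 : HR K -> A) m :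
  monoid_morphism f1 -> monoid_morphism f2 ->
  (forall t, t \in finsupp m -> f1 (tree_elt t) = f2 (tree_elt t)) ->
  f1 << m >> = f2 << m >>.
Proof.
move=> m1 m2 e; rewrite forestE !monoid_morphism_prod // !big_seq.
by apply: eq_bigr => t; rewrite mem_forest_seq; exact: e.
Qed.

Definition Bplus : HR K -> HR K := basis_lift (fun m => tree_elt (graft m)).

HB.instance Definition _ := GRing.Linear.copy Bplus
  (basis_lift (fun m => tree_elt (graft m))).

Definition counit g : K := g@_mone.

Fixpoint ptree_coproduct (t : ptree) : HR2 K :=
  let: PNode l := t in
  tens (tree_elt (rtree_of t)) 1
  + tens_map id Bplus (\prod_(x <- map ptree_coproduct l) x).

Definition coproduct : HR K -> HR2 K :=
  alg_lift (fun t => ptree_coproduct (val t)).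

HB.instance Definition _ := GRing.Linear.copy coproduct
  (alg_lift (fun t => ptree_coproduct (val t))).

Lemma coproduct_morph : monoid_morphism coproduct.
Proof. exact: alg_lift_morph. Qed.

Lemma Bplus_linear : linear Bplus. Proof. exact: linearP. Qed.
Lemma coproduct_linear : linear coproduct. Proof. exact: linearP. Qed.
Lemma id_linear (V : lmodType K) : linear (id : V -> V).
Proof. by []. Qed.

Lemma prod_children (A : comAlgType K) (h : ptree -> A) m :
  \prod_(x <- map h (pchildren (forest_node m))) x =
  \prod_(t <- forest_seq m) h (val t).
Proof.
rewrite /= big_map.
have e : perm_eq (sort ptree_le (map val (forest_seq m))) (map val (forest_seq m)).
  by rewrite perm_sort.
by rewrite (perm_big _ e) big_map.
Qed.

Lemma coproduct_Bplus g :
  coproduct (Bplus g) = tens (Bplus g) 1 + tens_map id Bplus (coproduct g).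
Proof.
move: g; apply: basis_ext => [a x y|a x y|m].
- by rewrite Bplus_linear coproduct_linear.
- rewrite coproduct_linear Bplus_linear tens_linearl tens_map_linear scalerDr.
  exact: addrACA.
rewrite {1 2}/Bplus !basis_liftU {1}/coproduct alg_liftE.
rewrite -[in RHS](val_rtreeK (graft m)).
have := prod_children ptree_coproduct m.
rewrite [val (graft m)]/= /forest_node [pchildren _]/= => e.
rewrite [LHS]/= e; congr (_ + tens_map _ _ _).
by rewrite /coproduct /alg_lift basis_liftU.
Qed.

Lemma coproduct_unique (D : HR K -> HR2 K) :
  linear D -> monoid_morphism D ->
  (forall g, D (Bplus g) = tens (Bplus g) 1 + tens_map id Bplus (D g)) ->
  D =1 coproduct.
Proof.
move=> lD mD DB; apply: basis_ext lD coproduct_linear _ => m.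
apply: (alg_ext_forest mD coproduct_morph) => t _.
elim/rtree_graft_ind: t => {}m IH.
rewrite (_ : tree_elt (graft m) = Bplus << m >>); last first.
  by rewrite /Bplus basis_liftU.
rewrite DB coproduct_Bplus; congr (_ + tens_map _ _ _).
exact: (alg_ext_forest mD coproduct_morph IH).
Qed.

Definition conv {A : comAlgType K} (phi psi : HR K -> A) : HR K -> A :=
  tens_mul phi psi \o coproduct.

(* antipode_rec t = (S (x) id) (Delta t): since S * id vanishes on trees, the
   recursion for Delta determines it, and S t, from the subtrees of t. *)
Fixpoint antipode_rec (t : ptree) : HR2 K :=
  let: PNode l := t in
  let p := tens_map id Bplus (\prod_(x <- map antipode_rec l) x) in
  p - tens (tens_mul id id p) 1.

Definition ptree_antipode (t : ptree) : HR K :=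
  let: PNode l := t in
  - tens_mul id id (tens_map id Bplus (\prod_(x <- map antipode_rec l) x)).

Definition antipode : HR K -> HR K :=
  alg_lift (fun t => ptree_antipode (val t)).

HB.instance Definition _ := GRing.Linear.copy antipode
  (alg_lift (fun t => ptree_antipode (val t))).

Lemma tens_mul_morph (A : comAlgType K) (f g : HR K -> A) :
  monoid_morphism f -> monoid_morphism g -> monoid_morphism (tens_mul f g).
Proof.
move=> [f1 fM] [g1 gM]; apply: basis_liftM => [|p q] /=.
  by rewrite f1 g1 mulr1.
by rewrite -!malgUM fM gM mulrACA.
Qed.

Lemma tens_mul_linear (A : comAlgType K) (f g : HR K -> A) :
  linear (tens_mul f g).
Proof. by move=> a x y; rewrite /tens_mul linearP. Qed.

Lemma tens_mulU (A : comAlgType K) (f g : HR K -> A) (p : forest * forest) :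
  tens_mul f g << p >> = f << p.1 >> * g << p.2 >>.
Proof. exact: basis_liftU. Qed.

Lemma conv_linear (A : comAlgType K) (f g : HR K -> A) : linear (conv f g).
Proof. by move=> a x y; rewrite /conv /= linearP tens_mul_linear. Qed.

Lemma conv_morph (A : comAlgType K) (f g : HR K -> A) :
  monoid_morphism f -> monoid_morphism g -> monoid_morphism (conv f g).
Proof.
move=> mf mg; case: (tens_mul_morph mf mg) => t1 tM.
case: coproduct_morph => c1 cM.
by split=> [|x y]; rewrite /conv /= ?c1 // cM tM.
Qed.

Lemma id_morph (A : comAlgType K) : monoid_morphism (id : A -> A).
Proof. by []. Qed.

Lemma antipode_morph : monoid_morphism antipode.
Proof. exact: alg_lift_morph. Qed.

Lemma antipode_linear : linear antipode. Proof. exact: linearP. Qed.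

Lemma rtree_graftP t : t = graft (seq_forest (branches t)).
Proof. by rewrite graft_branches. Qed.

Lemma tree_eltE m : tree_elt (graft m) = Bplus << m >>.
Proof. by rewrite /Bplus basis_liftU. Qed.

Lemma antipode_recE t :
  antipode_rec (val t) = tens_map antipode id (coproduct (tree_elt t)) /\
  antipode (tree_elt t) =
    - tens_mul antipode Bplus (coproduct << seq_forest (branches t) >>).
Proof.
elim/rtree_graft_ind: t => m IH.
have eb : seq_forest (branches (graft m)) = m.
  by rewrite (seq_forest_perm (perm_branches_graft m)) forest_seqK.
rewrite eb.
have pE : \prod_(x <- map antipode_rec (pchildren (forest_node m))) x
          = tens_map antipode id (coproduct << m >>).
  rewrite prod_children forestE (monoid_morphism_prod _ _ coproduct_morph).
  rewrite (monoid_morphism_prod _ _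
    (tens_map_morph antipode_morph (id_morph _))) !big_seq.
  by apply: eq_bigr => t; rewrite mem_forest_seq => /IH[].
set p := tens_map id Bplus (\prod_(x <- map antipode_rec (pchildren (forest_node m))) x).
have pE' : p = tens_map antipode id (tens_map id Bplus (coproduct << m >>)).
  rewrite /p pE; move: (coproduct _); apply: basis_ext => [a x y|a x y|[m1 m2]].
  - by rewrite !tens_map_linear.
  - by rewrite !tens_map_linear.
  rewrite -tensUU; apply: etrans (congr1 _ (tens_mapE _ _ antipode_linear (@id_linear _))) _.
  apply: etrans (tens_mapE _ _ (@id_linear _) Bplus_linear) _.
  apply/esym; apply: etrans (congr1 _ (tens_mapE _ _ (@id_linear _) Bplus_linear)) _.
  exact: (tens_mapE _ _ antipode_linear (@id_linear _)).
have SE : antipode (tree_elt (graft m)) = - tens_mul id id p.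
  by rewrite /antipode alg_liftE.
have pM : tens_mul id id p = tens_mul antipode Bplus (coproduct << m >>).
  rewrite pE'; move: (coproduct _); apply: basis_ext => [a x y|a x y|[m1 m2]].
  - by rewrite !tens_map_linear tens_mul_linear.
  - by rewrite tens_mul_linear.
  rewrite -tensUU.
  have -> : tens_map antipode id (tens_map id Bplus (tens << m1 >> << m2 >>)) =
      tens (antipode << m1 >>) (Bplus << m2 >>).
    apply: etrans (congr1 _ (tens_mapE _ _ (@id_linear _) Bplus_linear)) _.
    exact: (tens_mapE _ _ antipode_linear (@id_linear _)).
  apply: etrans (tens_mulE _ _ (@id_linear _) (@id_linear _)) _.
  exact/esym/(tens_mulE _ _ antipode_linear Bplus_linear).
split; last first.
  exact: (etrans SE (congr1 (fun x => - x) pM)).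
have -> : antipode_rec (val (graft m)) = p - tens (tens_mul id id p) 1.
  exact: erefl.
rewrite tree_eltE coproduct_Bplus pE' addrC.
have addE (x y : HR2 K) : tens_map antipode id (x + y) =
    tens_map antipode id x + tens_map antipode id y.
  by have := tens_map_linear antipode id 1 x y; rewrite !scale1r.
rewrite addE (tens_mapE _ _ antipode_linear (@id_linear _)).
rewrite -tree_eltE SE -pE'; congr (_ + _).
have := tens_linearl (1 : HR K) (-1) (tens_mul id id p) 0.
by rewrite {3}/tens linear0 !addr0 !scaleN1r => ->.
Qed.

Lemma antipode_Bplus g : antipode (Bplus g) = - conv antipode Bplus g.
Proof.
move: g; apply: basis_ext => [a x y|a x y|m].
- by rewrite Bplus_linear antipode_linear.
- by rewrite conv_linear opprD scalerN.
have [_] := antipode_recE (graft m).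
rewrite (seq_forest_perm (perm_branches_graft m)) forest_seqK tree_eltE.
exact.
Qed.

Definition unit_counit g : HR K := counit g *: 1.

Lemma unit_counit_linear : linear unit_counit.
Proof.
by move=> a x y; rewrite /unit_counit /counit mcoeffD mcoeffZ scalerDl scalerA.
Qed.

Lemma counitU m : counit << m >> = (m == mone)%:R.
Proof. by rewrite /counit mcoeffU. Qed.

Lemma counit_tree t : counit (tree_elt t) = 0.
Proof. by rewrite counitU cm1_eq1. Qed.

Lemma counit_Bplus g : counit (Bplus g) = 0.
Proof.
pose z : HR K -> HR K := fun=> 0.
have : unit_counit (Bplus g) = z g.
  move: g; apply: basis_ext => [a x y|a x y|m].
  - by rewrite Bplus_linear unit_counit_linear.
  - by rewrite /z scaler0 addr0.
  by rewrite -tree_eltE /unit_counit counit_tree scale0r.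
rewrite /unit_counit /z => /(congr1 (fun h : HR K => h@_mone)).
by rewrite mcoeffZ mcoeff0 mcoeff1 eqxx mulr1.
Qed.

Lemma unit_counit_morph : monoid_morphism unit_counit.
Proof.
split=> [|x y]; rewrite /unit_counit /counit.
  by rewrite mcoeff1 eqxx scale1r.
by rewrite (rmorphM (@mcoeff forest K mone)) -scalerAr mulr1 scalerA mulrC.
Qed.

Lemma alg_ext (A : comAlgType K) (f1 f2 : HR K -> A) :
  linear f1 -> linear f2 -> monoid_morphism f1 -> monoid_morphism f2 ->
  (forall t, f1 (tree_elt t) = f2 (tree_elt t)) -> f1 =1 f2.
Proof.
move=> l1 l2 m1 m2 e; apply: basis_ext => // m.
by apply: alg_ext_forest => // t _.
Qed.

Lemma tens_mulD (A : comAlgType K) (f g : HR K -> A) x y :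
  tens_mul f g (x + y) = tens_mul f g x + tens_mul f g y.
Proof. by have := tens_mul_linear f g 1 x y; rewrite !scale1r. Qed.

Lemma conv_Bplus (A : comAlgType K) (phi psi : HR K -> A) g :
  linear phi -> linear psi -> psi 1 = 1 ->
  conv phi psi (Bplus g) = phi (Bplus g) + conv phi (psi \o Bplus) g.
Proof.
move=> lphi lpsi psi1; rewrite /conv /= coproduct_Bplus tens_mulD.
rewrite (tens_mulE _ _ lphi lpsi) psi1 mulr1; congr (_ + _).
have lpB : linear (psi \o Bplus) by move=> a x y /=; rewrite Bplus_linear lpsi.
move: (coproduct g); apply: basis_ext => [a x y|a x y|[m1 m2]].
- by rewrite tens_map_linear tens_mul_linear.
- by rewrite tens_mul_linear.
rewrite -tensUU (tens_mulE _ _ lphi lpB).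
apply: etrans (congr1 _ (tens_mapE _ _ (@id_linear _) Bplus_linear)) _.
exact: (tens_mulE _ _ lphi lpsi).
Qed.

Lemma antipode_left : conv antipode id =1 unit_counit.
Proof.
apply: alg_ext => [|||| t]; first exact: conv_linear.
- exact: unit_counit_linear.
- by apply: conv_morph; [exact: antipode_morph | exact: id_morph].
- exact: unit_counit_morph.
rewrite [t]rtree_graftP tree_eltE conv_Bplus //; last exact: antipode_linear.
rewrite antipode_Bplus addNr /unit_counit counit_Bplus scale0r.
by [].
Qed.

Lemma tens_mul_map {M1 M2 N1 N2 : choiceType} (A : algType K)
    (f' : {malg K[M1]} -> {malg K[N1]}) (g' : {malg K[M2]} -> {malg K[N2]})
    (f : {malg K[N1]} -> A) (g : {malg K[N2]} -> A) x :
  linear f -> linear g ->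
  tens_mul f g (tens_map f' g' x) = tens_mul (f \o f') (g \o g') x.
Proof.
move=> lf lg; move: x; apply: basis_ext => [a x y|a x y|[m1 m2]].
- by rewrite tens_map_linear /tens_mul linearP.
- by rewrite /tens_mul linearP.
rewrite {1}/tens_map basis_liftU tens_mulE //.
by rewrite /tens_mul basis_liftU.
Qed.

Definition tens_assoc :
    {malg K[(forest * (forest * forest))%type]} ->
    {malg K[(forest * forest * forest)%type]} :=
  basis_lift (fun p => << ((p.1, p.2.1), p.2.2) >>).

Lemma tens_assoc_linear : linear tens_assoc.
Proof. by move=> a x y; rewrite /tens_assoc linearP. Qed.

Lemma tens_assoc_morph : monoid_morphism tens_assoc.
Proof. by apply: basis_liftM => // p q; rewrite malgUM. Qed.

Lemma tens_assocE (u v w : HR K) :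
  tens_assoc (tens u (tens v w)) = tens (tens u v) w.
Proof.
move: u; apply: basis_ext => [a x y|a x y|m1].
- by rewrite tens_linearl tens_assoc_linear.
- by rewrite !tens_linearl.
move: v; apply: basis_ext => [a x y|a x y|m2].
- by rewrite tens_linearl tens_linearr tens_assoc_linear.
- by rewrite tens_linearr tens_linearl.
move: w; apply: basis_ext => [a x y|a x y|m3].
- by rewrite !tens_linearr tens_assoc_linear.
- by rewrite !tens_linearr.
have e : tens << m1 >> (tens << m2 >> << m3 >>) = << (m1, (m2, m3)) >>
  :> {malg K[(forest * (forest * forest))%type]}.
  exact: etrans (congr1 _ (tensUU _ _)) (tensUU _ _).
rewrite e /tens_assoc basis_liftU; apply/esym.
exact: etrans (congr1 (fun x => tens x _) (tensUU _ _)) (tensUU _ _).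
Qed.

Let dl (x : HR2 K) := tens_map coproduct id x.
Let dr (x : HR2 K) := tens_assoc (tens_map id coproduct x).
Let b3 (x : {malg K[(forest * forest * forest)%type]}) := tens_map id Bplus x.

Let linearD1 (V W : lmodType K) (f : V -> W) : linear f ->
  {morph f : x y / x + y}.
Proof. by move=> lf x y; have := lf 1 x y; rewrite !scale1r. Qed.

Let linearZ1 (V W : lmodType K) (f : V -> W) : linear f ->
  forall a x, f (a *: x) = a *: f x.
Proof.
move=> lf a x; have f0 : f 0 = 0.
  by have := lf (-1) 0 0; rewrite scaler0 addr0 scaleN1r addNr.
by have := lf a x 0; rewrite f0 !addr0.
Qed.

Let dlE u v : dl (tens u v) = tens (coproduct u) v.
Proof. exact: (tens_mapE _ _ coproduct_linear (@id_linear _)). Qed.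

Let drE u v : dr (tens u v) = tens_assoc (tens u (coproduct v)).
Proof.
exact: (congr1 tens_assoc (tens_mapE _ _ (@id_linear _) coproduct_linear)).
Qed.

Let idBE u v : tens_map id Bplus (tens u v) = tens u (Bplus v) :> HR2 K.
Proof. exact: (tens_mapE _ _ (@id_linear _) Bplus_linear). Qed.

Let b3E (u : HR2 K) v : b3 (tens u v) = tens u (Bplus v).
Proof. exact: (tens_mapE _ _ (@id_linear _) Bplus_linear). Qed.

Let dl_linear : linear dl. Proof. exact: tens_map_linear. Qed.
Let dr_linear : linear dr.
Proof. by move=> a x y; rewrite /dr tens_map_linear tens_assoc_linear. Qed.
Let b3_linear : linear b3. Proof. exact: tens_map_linear. Qed.

Let dl_idB x : dl (tens_map id Bplus x) = b3 (dl x).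
Proof.
move: x; apply: basis_ext => [a x y|a x y|[m1 m2]].
- by rewrite tens_map_linear dl_linear.
- by rewrite dl_linear b3_linear.
rewrite -tensUU; apply: etrans (congr1 dl (idBE _ _)) _.
apply: etrans (dlE _ _) _; apply/esym.
exact: etrans (congr1 b3 (dlE _ _)) (b3E _ _).
Qed.

Let assoc_idB u x :
  tens_assoc (tens u (tens_map id Bplus x)) = b3 (tens_assoc (tens u x)).
Proof.
move: x; apply: basis_ext => [a x y|a x y|[m1 m2]].
- by rewrite tens_map_linear tens_linearr tens_assoc_linear.
- by rewrite tens_linearr tens_assoc_linear b3_linear.
rewrite -tensUU.
apply: etrans (congr1 (fun y => tens_assoc (tens u y)) (idBE _ _)) _.
apply: etrans (tens_assocE _ _ _) _; apply/esym.
exact: etrans (congr1 b3 (tens_assocE _ _ _)) (b3E _ _).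
Qed.

Let dr_idB x :
  dr (tens_map id Bplus x) = tens (tens_map id Bplus x) 1 + b3 (dr x).
Proof.
move: x; apply: basis_ext => [a x y|a x y|[m1 m2]].
- by rewrite tens_map_linear dr_linear.
- rewrite tens_map_linear tens_linearl dr_linear b3_linear scalerDr.
  exact: addrACA.
rewrite -tensUU (idBE << m1 >> << m2 >>).
apply: etrans (drE _ _) _; rewrite coproduct_Bplus.
apply/esym/(etrans (congr2 (fun x y => x + y) erefl (congr1 b3 (drE _ _))))/esym.
rewrite (linearD1 (tens_linearr _)) (linearD1 tens_assoc_linear).
exact: congr2 (tens_assocE _ _ _) (assoc_idB _ _).
Qed.

Let dl_morph : monoid_morphism (dl \o coproduct).
Proof.
have [f1 fM] := tens_map_morph coproduct_morph (id_morph (HR K)).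
have [c1 cM] := coproduct_morph.
by split=> [|x y]; rewrite /dl /= ?c1 // cM fM.
Qed.

Let dr_morph : monoid_morphism (dr \o coproduct).
Proof.
have [f1 fM] := tens_map_morph (id_morph (HR K)) coproduct_morph.
have [c1 cM] := coproduct_morph; have [t1 tM] := tens_assoc_morph.
by split=> [|x y]; rewrite /dr /= ?c1 ?f1 // cM fM tM.
Qed.

Let add_swap (V : zmodType) (x1 x2 y1 y2 a b c c' : V) :
  x1 = a -> x2 = b + c -> c = c' -> y1 = a + b -> y2 = c' -> x1 + x2 = y1 + y2.
Proof. by move=> -> -> -> -> ->; rewrite addrA. Qed.

Lemma coproduct_coassoc g :
  tens_assoc (tens_map id coproduct (coproduct g)) =
  tens_map coproduct id (coproduct g).
Proof.
rewrite -/(dr _) -/(dl _); move: g.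
apply: (alg_ext (f1 := dr \o coproduct) (f2 := dl \o coproduct)) => [a x y|a x y|||t].
- by rewrite /= coproduct_linear dr_linear.
- by rewrite /= coproduct_linear dl_linear.
- exact: dr_morph.
- exact: dl_morph.
elim/rtree_graft_ind: t => m IH.
have e : (dr \o coproduct) << m >> = (dl \o coproduct) << m >>.
  exact: (alg_ext_forest dr_morph dl_morph IH).
rewrite /= tree_eltE coproduct_Bplus (linearD1 dr_linear) (linearD1 dl_linear).
have [c1 _] := coproduct_morph.
have e1 u : dr (tens u 1) = tens (tens u 1) 1.
  apply: etrans (drE _ _) _; rewrite c1 -tens11; exact: tens_assocE.
have e2 : b3 (dr (coproduct << m >>)) = b3 (dl (coproduct << m >>)).
  by move: e => /= ->.
have e3 : dl (tens (Bplus << m >>) 1) =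
    tens (tens (Bplus << m >>) 1) 1 +
    tens (tens_map id Bplus (coproduct << m >>)) 1.
  apply: etrans (dlE _ _) _; rewrite coproduct_Bplus.
  exact: (linearD1 (tens_linearl _)).
exact: (add_swap (e1 _) (dr_idB _) e2 e3 (dl_idB _)).
Qed.

Lemma convA (A : comAlgType K) (a b c : HR K -> A) :
  linear a -> linear b -> linear c ->
  conv (conv a b) c =1 conv a (conv b c).
Proof.
move=> la lb lc g.
have e1 : conv (conv a b) c g = tens_mul (tens_mul a b) c (dl (coproduct g)).
  by rewrite /dl tens_mul_map //; exact: tens_mul_linear.
have e2 : conv a (conv b c) g =
    tens_mul a (tens_mul b c) (tens_map id coproduct (coproduct g)).
  by rewrite tens_mul_map //; exact: tens_mul_linear.
rewrite e1 e2 /dl -coproduct_coassoc; move: (tens_map _ _ _).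
apply: basis_ext => [k x y|k x y|[m1 [m2 m3]]].
- by rewrite tens_assoc_linear /tens_mul linearP.
- by rewrite /tens_mul linearP.
by rewrite /tens_assoc /tens_mul !basis_liftU /= ?basis_liftU /= mulrA.
Qed.

Lemma tens_mul_unit (A : comAlgType K) (f : HR K -> A) x : linear f ->
  tens_mul (fun g => counit g *: (1 : A)) f x = f (tens_mul unit_counit id x).
Proof.
move=> lf; move: x; apply: basis_ext => [a x y|a x y|[m1 m2]].
- by rewrite /tens_mul linearP.
- by rewrite /tens_mul linearP lf.
rewrite /tens_mul !basis_liftU /= /unit_counit -!scalerAl !mul1r.
have f0 : f 0 = 0 by have := lf (-1) 0 0; rewrite scaler0 addr0 scaleN1r addNr.
by have := lf (counit << m1 >>) << m2 >> 0; rewrite !addr0 f0 addr0.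
Qed.

Lemma conv_counitl (A : comAlgType K) (f : HR K -> A) : linear f ->
  conv (fun g => counit g *: (1 : A)) f =1 f.
Proof.
move=> lf g; rewrite /conv /= tens_mul_unit //; congr f; move: g.
change (conv unit_counit id =1 id); apply: alg_ext => [||||t] //.
- exact: conv_linear.
- by apply: conv_morph; [exact: unit_counit_morph | exact: id_morph].
elim/rtree_graft_ind: t => m IH.
have e : conv unit_counit id << m >> = << m >>.
  apply: (alg_ext_forest _ (id_morph _) IH).
  exact: (conv_morph unit_counit_morph (id_morph _)).
rewrite tree_eltE.
apply: etrans (conv_Bplus _ unit_counit_linear (@id_linear _) erefl) _.
rewrite {1}/unit_counit counit_Bplus scale0r add0r.
exact: etrans (tens_mul_unit _ Bplus_linear) (congr1 Bplus e).
Qed.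

Lemma eq_conv (A : comAlgType K) (a a' b b' : HR K -> A) :
  a =1 a' -> b =1 b' -> conv a b =1 conv a' b'.
Proof. by move=> /funext -> /funext ->. Qed.

Lemma antipode_right : conv id antipode =1 unit_counit.
Proof.
pose S2 := antipode \o antipode.
have lS := antipode_linear; have [S1 SM] := antipode_morph.
have lS2 : linear S2 by move=> a x y; rewrite /S2 /= !lS.
have lI := @id_linear (HR K).
have S2S : conv S2 antipode =1 unit_counit.
  move=> g; have : antipode (conv antipode id g) = conv S2 antipode g.
    rewrite /conv /=; move: (coproduct g).
    apply: basis_ext => [a x y|a x y|p].
    - by rewrite tens_mul_linear lS.
    - by rewrite tens_mul_linear.
    apply: etrans (congr1 antipode (tens_mulU _ _ _)) _.
    apply: etrans (SM _ _) (esym (tens_mulU S2 antipode p)).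
  move=> <-; rewrite antipode_left /unit_counit.
  exact: etrans (linearZ1 lS _ _) (congr1 (fun x => _ *: x) S1).
move=> g; have lIS : linear (conv id antipode) by exact: conv_linear.
apply: etrans (esym (conv_counitl lIS g)) _.
apply: etrans (esym (eq_conv S2S (frefl _) g)) _.
apply: etrans (convA lS2 lS lIS g) _.
have h : conv antipode (conv id antipode) =1 antipode.
  move=> x; apply: etrans (esym (convA lS lI lS x)) _.
  exact: etrans (eq_conv antipode_left (frefl _) x) (conv_counitl lS x).
exact: (etrans (@eq_conv _ S2 S2 _ _ (frefl S2) h g) (S2S g)).
Qed.

Definition is_antipode (S : HR K -> HR K) : Prop :=
  [/\ linear S, conv S id =1 unit_counit & conv id S =1 unit_counit].

Lemma antipodeP : is_antipode antipode.
Proof.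
by split; [exact: antipode_linear | exact: antipode_left | exact: antipode_right].
Qed.

Lemma is_antipode_unique S : is_antipode S -> S =1 antipode.
Proof.
case=> lS SI IS; have lA := antipode_linear; have lI := @id_linear (HR K).
move=> g; apply: etrans (esym (conv_counitl lS g)) _.
apply: etrans (esym (eq_conv antipode_left (frefl _) g)) _.
apply: etrans (convA lA lI lS g) _.
apply: etrans (eq_conv (frefl _) IS g) _.
apply: etrans (esym (eq_conv (frefl _) antipode_right g)) _.
apply: etrans (esym (convA lA lI lA g)) _.
exact: etrans (eq_conv antipode_left (frefl _) g) (conv_counitl lA g).
Qed.

End HopfAlgebra.

Local Open Scope classical_set_scope.
Local Open Scope complex_scope.

HB.instance Definition _ (R : realType) := GRing.ComAlgebra.copy R[i] (R[i]^o).
HB.instance Definition _ (R : realType) := NormedModule.copy R[i] (R[i]^o).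

Section ToyModel.
Context {R : realType}.
Implicit Types (x s mu : R) (z : R[i]).

Definition posreal : set R := `]0, +oo[.

(* x ^ z = exp (z ln x), meant for x > 0 *)
Definition cpow x z : R[i] :=
  (expR (complex.Re z * ln x))%:C *
  (cos (complex.Im z * ln x) +i* sin (complex.Im z * ln x)).

Definition cmeasurable (D : set R) (f : R -> R[i]) : Prop :=
  measurable_fun D (fun x => complex.Re (f x)) /\
  measurable_fun D (fun x => complex.Im (f x)).

(* absolute convergence of the integral of f over D *)
Definition cintegrable (D : set R) (f : R -> R[i]) : Prop :=
  lebesgue_measure.-integrable D (fun x => (complex.Re (f x))%:E) /\
  lebesgue_measure.-integrable D (fun x => (complex.Im (f x))%:E).

Definition cintegral (D : set R) (f : R -> R[i]) : R[i] :=
  (\int[lebesgue_measure]_(x in D) complex.Re (f x))%R +i*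
  (\int[lebesgue_measure]_(x in D) complex.Im (f x))%R.

(* G(z) = c_0 z^(-N) + c_1 z^(1-N) + ... on the punctured disc 0 < |z| < r *)
Definition laurent (N : nat) (c : nat -> R[i]) (r : R) (G : R[i] -> R[i]) :
    Prop :=
  forall z, 0 < `|z| < r%:C ->
    [series c k * z ^ (k%:Z - N%:Z)]_k @ \oo --> G z.

Definition simple_pole0 (G : R[i] -> R[i]) : Prop :=
  exists c r, [/\ 0 < r, c 0%N != 0 & laurent 1 c r G].

(* f is a function on the positive reals: its values at x <= 0 are irrelevant *)
Record admissible (f : R -> R[i]) : Prop := Admissible {
  admissible_measurable : cmeasurable posreal f;
  admissible_bigO :
    exists M : R, \forall x \near +oo, `|f x| <= (M * x^-1)%:C;
  admissible_mellin : exists delta : R, [/\ 0 < delta,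
    forall z, 0 < complex.Re z < delta ->
      cintegrable posreal (fun x => f x * cpow x (- z)) &
    exists (G : R[i] -> R[i]) (r : R), [/\ 0 < r, simple_pole0 G &
      forall z, 0 < complex.Re z < delta -> `|z| < r%:C ->
        G z = cintegral posreal (fun x => f x * cpow x (- z))]]
}.

(* phi s z g is the value at s > 0 and z of the regularized rules on g, together
   with its meromorphic extension in z.  As phi is a total function, its values
   outside the domains of rules_Bplus and rules_meromorphic are arbitrary up to
   multiplicativity, which leaves the germ at z = 0 unique. *)
Record regularized_rules (f : R -> R[i])
    (phi : R -> R[i] -> HR R[i] -> R[i]) : Prop := RegularizedRules {
  rules_linear : forall s z, 0 < s -> scalar (phi s z);
  rules_morphism : forall s z, 0 < s -> monoid_morphism (phi s z);
  rules_Bplus : forall g, exists2 eps : R, 0 < eps &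
    forall s z, 0 < s -> 0 < complex.Re z < eps ->
      let F x := cpow (s * x) (- z) * f x * phi (s * x) z g in
      cintegrable posreal F /\ phi s z (Bplus g) = cintegral posreal F;
  rules_meromorphic : forall g, exists2 r : R, 0 < r &
    forall s, 0 < s -> exists N c, laurent N c r (fun z => phi s z g)
}.

Definition counterterms (phi : R -> R[i] -> HR R[i] -> R[i]) mu z :
    HR R[i] -> R[i] :=
  phi mu z \o antipode.

Definition renormalized (phi : R -> R[i] -> HR R[i] -> R[i]) mu s z :
    HR R[i] -> R[i] :=
  conv (counterterms phi mu z) (phi s z).

End ToyModel.

(* Main.v *)
Require Import Defs.
From HB Require Import structures.
From mathcomp Require Import all_boot all_order all_algebra.
From mathcomp Require Import finmap.
From mathcomp.multinomials Require Import monalg.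
From mathcomp Require Import complex.
From mathcomp Require Import all_classical all_reals all_analysis.
From mathcomp Require Import ring lra zify.

Set Implicit Arguments.
Unset Strict Implicit.
Unset Printing Implicit Defensive.

Import Order.TTheory GRing.Theory Num.Theory numFieldNormedType.Exports.

Local Open Scope ring_scope.
Local Open Scope classical_set_scope.
Local Open Scope complex_scope.

(** Put u = s^(-z), and let F be the Mellin transform of f together with its
   continuation (G below). By scaling, the integral over a new root multiplies
   u^n by F((n+1)z) u, so that the rules at s are obtained by evaluating at X = u
   the algebra morphism [toy_poly] from HR to polynomials for which B_+ becomes
   the linear map X^n |-> F((n+1)z) X^(n+1), called [graft_op]. This gives the
   existence of the regularized rules: the integrals over the root are finite
   sums of Mellin transforms ([toy_rules_Bplus]), and the coefficients are
   polynomials in the functions F(jz), which have Laurent expansions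
   ([toy_rules_meromorphic]). Any other choice of rules agrees with this one on
   a strip 0 < Re z < eps by induction on trees, hence on a punctured disc by
   the identity theorem ([rules_unique]).

   In the variable y = (s/mu)^(-z), the renormalized rules are again the values
   of a polynomial P_z(g) which is multiplicative in g, and
     P_z(B_+ g) = constant + mu^(-z) graft_op (P_z(g))
   with the constant such that P_z(B_+ g) vanishes at y = 1, that is at s = mu
   ([renormalized_poly_Bplus], [renormalized_poly1]).

   The poles cancel for the following reason. Let p_n(z) be the coefficients of
   P_z, of pole order at most K, and x = ln (s/mu). Expanding the exponential in
   sum_n p_n(z) exp(-nxz) produces the moments sum_n p_n(z) (nz)^j. If they all
   converge as z tends to 0, then so does the sum, and the limit is a polynomial
   of degree at most K in x, the remainder of the expansion being small compared
   with z^K ([clim_regular_family]). Convergence of the moments is inherited by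
   linear combinations and, by the binomial formula, by products. It is inherited
   by grafting ([regular_family_graft]): the moment of order j > 0 becomes
   sum_n p_n(z) h((n+1)z) with h(w) = w^j F(w), and h is holomorphic at 0 because
   the pole of F has order one, so that this is a combination of moments of
   X P_z; the moment of order 0 is the value at y = 1, which the subtraction makes
   vanish. As mu^(-z) tends to 1, the limits of the moments, and the polynomial
   that they determine, depend on g only. *)

(** * Limits and Cauchy products of complex series *)

Section ComplexSeries.
Context {R : realType}.
Local Notation C := R[i].
Implicit Types (u : nat -> C) (w z : C).

Lemma gt0_complexE (e : C) : 0 < e -> exists2 d : R, 0 < d & e = d%:C.
Proof.
move=> e0; exists (complex.Re e); last by rewrite RRe_real // gtr0_real.
by move: e0; rewrite ltcE => /andP[].
Qed.

(** Convergence of complex valued functions, wrapped in a record so that it is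
   handled as a relation between a function and its limit instead of an inclusion
   of filters. *)
Record clim {T : Type} (F : set_system T) (f : T -> C) (a : C) : Prop :=
  Clim { climE : f x @[x --> F] --> a }.

Section Limits.
Context {T : Type} (F : set_system T) {FF : Filter F}.
Implicit Types (f g : T -> C) (a b : C).

Lemma clim_cst a : clim F (fun _ => a) a.
Proof. apply: Clim. exact: cvg_cst. Qed.

Lemma clim_near f g a : clim F f a -> (\forall x \near F, f x = g x) -> clim F g a.
Proof. by move=> [h] fg; split; apply: (cvg_trans _ h); exact: near_eq_cvg. Qed.

Lemma clim_eq f g a : clim F f a -> f =1 g -> clim F g a.
Proof. by move=> + /funext <-. Qed.

Lemma climD f g a b : clim F f a -> clim F g b ->
  clim F (fun x => f x + g x) (a + b).
Proof. by case=> fa [gb]; apply: Clim; exact: (cvgD fa gb). Qed.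

Lemma climB f g a b : clim F f a -> clim F g b ->
  clim F (fun x => f x - g x) (a - b).
Proof. by case=> fa [gb]; apply: Clim; exact: (cvgB fa gb). Qed.

Lemma climM f g a b : clim F f a -> clim F g b ->
  clim F (fun x => f x * g x) (a * b).
Proof. by case=> fa [gb]; apply: Clim; exact: (cvgM fa gb). Qed.

Lemma climX f a n : clim F f a -> clim F (fun x => f x ^+ n) (a ^+ n).
Proof.
move=> fa; elim: n => [|n IH]; first exact: clim_cst.
by rewrite exprS; apply: clim_eq (climM fa IH) _ => x; rewrite exprS.
Qed.

Lemma clim_sum (I : Type) (r : seq I) (P : pred I) (f : I -> T -> C) (a : I -> C) :
  (forall i, P i -> clim F (f i) (a i)) ->
  clim F (fun x => \sum_(i <- r | P i) f i x) (\sum_(i <- r | P i) a i).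
Proof.
move=> fa; elim: r => [|i r IH].
  by rewrite big_nil; apply: clim_eq (clim_cst 0) _ => x; rewrite big_nil.
rewrite big_cons; case: ifP => Pi.
  by apply: clim_eq (climD (fa i Pi) IH) _ => x; rewrite big_cons Pi.
by apply: clim_eq IH _ => x; rewrite big_cons Pi.
Qed.

Lemma clim_unique {PF : ProperFilter F} f a b : clim F f a -> clim F f b -> a = b.
Proof. by move=> [fa] [fb]; exact: (cvg_unique _ fa fb). Qed.

Lemma climP f a : clim F f a <->
  forall e : R, 0 < e -> \forall x \near F, `|a - f x| < e%:C.
Proof.
split=> [[/cvgrPdist_lt h] e e0|h]; first by apply: h; rewrite ltcR.
by split; apply/cvgrPdist_lt => _ /gt0_complexE[e e0 ->]; exact: h.
Qed.

End Limits.

Lemma clim_majorant u w (v : nat -> R) :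
  (forall n, `|w - u n| <= (v n)%:C) -> v @ \oo --> 0 -> clim \oo u w.
Proof.
move=> uv v0; apply/climP => e e0.
move/cvgr0Pnorm_lt : v0 => /(_ _ e0); apply: filterS => n vn.
by rewrite (le_lt_trans (uv n)) // ltcR (le_lt_trans _ vn) // ler_norm.
Qed.

Lemma normc_le_ReIm w : `|w| <= (`|complex.Re w| + `|complex.Im w|)%:C.
Proof.
rewrite {1}[w]complexE (le_trans (ler_normD _ _)) // rmorphD /= lerD //.
  by rewrite normc_def /= expr0n /= addr0 sqrtr_sqr.
rewrite normrM normc_def /= expr0n /= add0r expr1n sqrtr1 mul1r.
by rewrite normc_def /= expr0n /= addr0 sqrtr_sqr.
Qed.

Lemma clim_complex u w : (fun n => complex.Re (u n)) @ \oo --> complex.Re w ->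
  (fun n => complex.Im (u n)) @ \oo --> complex.Im w -> clim \oo u w.
Proof.
move=> hR hI; apply: (clim_majorant (v := fun n =>
  `|complex.Re w - complex.Re (u n)| + `|complex.Im w - complex.Im (u n)|)).
  by move=> n; apply: le_trans (normc_le_ReIm _) _; case: (u n) (w) => a b [c d].
rewrite -[0 in X in _ --> X]addr0 -(normr0 R); apply: cvgD; apply: cvg_norm.
  by rewrite -(subrr (complex.Re w)); apply: cvgB => //; exact: cvg_cst.
by rewrite -(subrr (complex.Im w)); apply: cvgB => //; exact: cvg_cst.
Qed.

Lemma realcM (x y : R) : (x * y)%:C = x%:C * y%:C.
Proof. exact: rmorphM. Qed.

Lemma realcD (x y : R) : (x + y)%:C = x%:C + y%:C.
Proof. exact: rmorphD. Qed.

Lemma realcV (x : R) : (x^-1)%:C = x%:C^-1.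
Proof. exact: fmorphV. Qed.

Lemma realcX (x : R) n : (x ^+ n)%:C = x%:C ^+ n.
Proof. exact: rmorphXn. Qed.

Lemma realc_nat n : (n%:R : R)%:C = n%:R.
Proof. exact: rmorph_nat. Qed.

Lemma normc_real w : `|w| = (complex.Re `|w|)%:C.
Proof. by rewrite RRe_real // normr_real. Qed.

Lemma normc_nneg (x : R) : 0 <= x -> `|x%:C| = x%:C.
Proof. by move=> x0; rewrite ger0_norm // ler0c. Qed.

Lemma norm_lt_radius (r : R) z : 0 < `|z| < r%:C ->
  exists2 x : R, 0 < x < r & `|z| = x%:C.
Proof.
rewrite normc_real => /andP[z0 zr]; exists (complex.Re `|z|) => //.
by move: z0 zr; rewrite !ltcR => -> ->.
Qed.

Definition cauchy_coef (a b : nat -> C) (k : nat) : C :=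
  \sum_(i < k.+1) a i * b (k - i)%N.

(** Each pair i + j < n lies on exactly one of the first n antidiagonals. *)
Lemma sum_cauchy_coef (a b : nat -> C) n :
  \sum_(0 <= k < n) cauchy_coef a b k =
  \sum_(i < n) \sum_(j < n | ~~ (n <= i + j)%N) a i * b j.
Proof.
rewrite big_mkord.
transitivity (\sum_(k < n) \sum_(i < n | (i < k.+1)%N) a i * b (k - i)%N).
  apply: eq_bigr => k _; rewrite /cauchy_coef.
  by rewrite (big_ord_widen n (fun i => a i * b (k - i)%N)).
rewrite (exchange_big_dep xpredT) //=; apply: eq_bigr => i _.
rewrite -(big_mkord (fun k => (i < k.+1)%N) (fun k => a i * b (k - i)%N)).
rewrite -(big_mkord (fun j => ~~ (n <= i + j)%N) (fun j => a i * b j)).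
rewrite (big_cat_nat (n := i)) ?(ltnW (ltn_ord i)) //= big_nat_cond big_pred0.
  rewrite Monoid.mul1m -{1}[i : nat]add0n big_addn.
  rewrite [RHS](big_cat_nat (n := n - i)) ?leq_subr //=.
  rewrite [X in _ = _ + X]big_nat_cond [X in _ = _ + X]big_pred0.
    rewrite addr0 [LHS]big_nat_cond [RHS]big_nat_cond.
    apply: eq_big => [j|j _]; last by rewrite addnK.
    rewrite ltnS leq_addl andbT /= -ltnNge ltn_subRL.
    by case: (i + j < n)%N.
  by move=> j; case: i => i /= hi; lia.
by move=> j; lia.
Qed.

Lemma cauchy_productB (a b : nat -> C) n :
  series a n * series b n - series (cauchy_coef a b) n =
  \sum_(i < n) \sum_(j < n | (n <= i + j)%N) a i * b j.
Proof.
rewrite /series /= sum_cauchy_coef !big_mkord big_distrlr /= -sumrB.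
apply: eq_bigr => i _.
by rewrite (bigID (fun j : 'I_n => (n <= i + j)%N)) /= addrK.
Qed.

(** The square of partial sums of order n exceeds the partial sum of the product
   by terms with i + j >= n. As q^(2(i+j)) <= q^n q^i q^j there, domination of
   both series by the powers of q^2 leaves q^n times two convergent geometric
   series. *)
Lemma clim_cauchy_product (a b : nat -> C) (A B q : R) (la lb : C) :
  0 <= A -> 0 <= B -> 0 <= q < 1 ->
  (forall i, `|a i| <= (A * (q * q) ^+ i)%:C) ->
  (forall i, `|b i| <= (B * (q * q) ^+ i)%:C) ->
  clim \oo (series a) la -> clim \oo (series b) lb ->
  clim \oo (series (cauchy_coef a b)) (la * lb).
Proof.
move=> A0 B0 /andP[q0 q1] ha hb ca cb.
have geoB n : \sum_(i < n) q ^+ i <= (1 - q)^-1.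
  rewrite -[leRHS]div1r ler_pdivlMr ?subr_gt0 // mulrC -opprB mulNr -subrX1.
  by rewrite opprB lerBlDr lerDl exprn_ge0.
have e : clim \oo (fun n => series a n * series b n -
    series (cauchy_coef a b) n) 0.
  apply: (clim_majorant (v := fun n => A * B * (1 - q)^-1 * (1 - q)^-1 * q ^+ n)).
    move=> n; rewrite sub0r normrN cauchy_productB.
    apply: le_trans (ler_norm_sum _ _ _) _.
    apply: (@le_trans _ _
      (\sum_(i < n) \sum_(j < n) (A * B * q ^+ n * (q ^+ i * q ^+ j))%:C)).
      apply: ler_sum => i _; apply: le_trans (ler_norm_sum _ _ _) _.
      rewrite [leRHS](bigID (fun j : 'I_n => (n <= i + j)%N)) /=.
      rewrite -[leLHS]addr0 lerD //; last first.
        by apply: sumr_ge0 => j _; rewrite ler0c !mulr_ge0 ?exprn_ge0.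
      apply: ler_sum => j nij; rewrite normrM.
      apply: le_trans (ler_pM _ _ (ha i) (hb j)) _ => //.
      rewrite -rmorphM lecR !exprMn.
      have -> : A * (q ^+ i * q ^+ i) * (B * (q ^+ j * q ^+ j)) =
          A * B * q ^+ (i + j) * (q ^+ i * q ^+ j) by rewrite exprD; ring.
      rewrite ler_wpM2r ?mulr_ge0 ?exprn_ge0 // ler_wpM2l ?mulr_ge0 //.
      by rewrite ler_wiXn2l // ltW.
    under eq_bigr do rewrite -rmorph_sum.
    rewrite -rmorph_sum lecR.
    under eq_bigr do rewrite -mulr_sumr -mulr_sumr.
    rewrite -mulr_sumr -mulr_suml.
    rewrite [leRHS](_ : _ = A * B * q ^+ n * ((1 - q)^-1 * (1 - q)^-1)); last by ring.
    rewrite ler_wpM2l ?mulr_ge0 ?exprn_ge0 //.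
    by rewrite ler_pM // sumr_ge0 // => i _; rewrite exprn_ge0.
  rewrite -(mulr0 (A * B * (1 - q)^-1 * (1 - q)^-1)); apply: cvgMl_tmp.
  by apply: cvg_expr; rewrite ger0_norm.
rewrite -[la * lb]subr0; apply: clim_eq (climB (climM ca cb) e) _ => n.
exact: subKr.
Qed.

End ComplexSeries.

Arguments clim_cst {R T} F {FF} a.

(** * Power series *)

Section PowerSeries.
Context {R : realType}.
Local Notation C := R[i].
Implicit Types (u : nat -> C) (w z : C) (c : nat -> C) (h : C -> C).

Lemma clim_bounded u w : clim \oo u w ->
  exists2 M : R, 0 <= M & forall n, `|u n| <= M%:C.
Proof.
move=> /climP/(_ _ ltr01)[N _ hN].
pose S := `|w| + 1 + \sum_(i < N) `|u i|.
have S0 : 0 <= S by rewrite /S !addr_ge0 // sumr_ge0.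
exists (complex.Re S); first by rewrite -ler0c RRe_real // ger0_real.
move=> n; rewrite RRe_real ?ger0_real // /S.
have [nN|Nn] := ltnP n N.
  rewrite (bigD1 (Ordinal nN)) //= addrCA lerDl !addr_ge0 // sumr_ge0 //.
have un : `|w - u n| < 1%:C := hN n Nn.
rewrite -[leLHS]addr0 lerD ?sumr_ge0 //.
rewrite (_ : u n = w - (w - u n)); last by rewrite subKr.
by rewrite (le_trans (ler_normB _ _)) // lerD // ltW.
Qed.

(** Convergence is required away from 0: this is what a Laurent expansion gives
   after multiplication by a power of z. *)
Definition power_series_on (r : R) c h : Prop :=
  forall z, 0 < `|z| < r%:C -> clim \oo (series (fun k => c k * z ^+ k)) (h z).

(** Cauchy estimate: the terms of the convergent series at rho are bounded. *)
Lemma power_series_coef_bound (r rho : R) c h :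
  power_series_on r c h -> 0 < rho < r ->
  exists2 M : R, 0 <= M & forall k, `|c k| <= (M * rho ^- k)%:C.
Proof.
move=> ch /andP[rho0 rhor].
have [|M M0 hM] := @clim_bounded _ _ (ch rho%:C _).
  by rewrite normc_nneg ?ltW // !ltcR rho0.
exists (M + M) => [|k]; first by rewrite addr_ge0.
have rk : 0 < rho ^+ k by rewrite exprn_gt0.
rewrite realcM realcV ler_pdivlMr ?ltcR // -normc_nneg; last by rewrite ltW.
rewrite -normrM realcX.
have -> : c k * rho%:C ^+ k = series (fun k => c k * rho%:C ^+ k) k.+1 -
   series (fun k => c k * rho%:C ^+ k) k.
  by rewrite /series /= big_nat_recr //= addrAC subrr add0r.
by apply: le_trans (ler_normB _ _) _; rewrite realcD lerD.
Qed.

(** The coefficients are dominated by the powers of 2/r, so that for |z| < r/4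
   the tail of the series is dominated by a geometric series of ratio 1/2. *)
Lemma power_series_remainder (r : R) c h d : 0 < r -> power_series_on r c h ->
  exists2 B : R, 0 <= B & forall z, 0 < `|z| < (r / 4)%:C ->
    `|h z - \sum_(k < d) c k * z ^+ k| <= B%:C * `|z| ^+ d.
Proof.
move=> r0 ch; have [|M M0 hM] := @power_series_coef_bound _ (r / 2) _ _ ch.
  by rewrite divr_gt0 //= ltr_pdivrMr // ltr_pMr // ltr1n.
exists (M * (r / 2) ^- d * 2).
  by rewrite !mulr_ge0 // invr_ge0 exprn_ge0 // divr_ge0 // ltW.
move=> z hz; have [x /andP[x0 xr] zx] := norm_lt_radius hz.
have zr : 0 < `|z| < r%:C.
  by rewrite zx !ltcR x0 /=; lra.
pose S n := \sum_(0 <= k < n) c k * z ^+ k.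
have tail n : (d <= n)%N -> `|S n - S d| <= (M * (r / 2) ^- d * 2)%:C * `|z| ^+ d.
  move=> dn; rewrite /S (big_cat_nat (n := d)) //= addrAC subrr add0r.
  apply: le_trans (ler_norm_sum _ _ _) _.
  rewrite -{1}[d]add0n big_addn big_mkord.
  apply: (@le_trans _ _ (\sum_(i < n - d) (M * (r / 2) ^- d * x ^+ d * 2^-1 ^+ i)%:C)).
    apply: ler_sum => i _; rewrite normrM normrX zx.
    apply: (@le_trans _ _ ((M * (r / 2) ^- (i + d))%:C * (x ^+ (i + d))%:C)).
      by rewrite realcX ler_wpM2r // exprn_ge0 // ler0c ltW.
    rewrite -realcM lecR addnC !exprD invfM.
    have -> : M * ((r / 2) ^- d * (r / 2) ^- i) * (x ^+ d * x ^+ i) =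
      M * (r / 2) ^- d * x ^+ d * (x / (r / 2)) ^+ i.
      by rewrite (expr_div_n x); ring.
    rewrite ler_wpM2l //.
      by rewrite !mulr_ge0 ?invr_ge0 ?exprn_ge0 ?divr_ge0 // ltW.
    rewrite lerXn2r ?nnegrE ?divr_ge0 ?invr_ge0 // ?ltW //.
    rewrite ltr_pdivrMr ?divr_gt0 //.
    by rewrite (lt_le_trans xr) //; lra.
  rewrite -rmorph_sum zx -realcX -realcM lecR -mulr_sumr.
  rewrite [leRHS](_ : _ = M * (r / 2) ^- d * x ^+ d * 2); last by ring.
  rewrite ler_wpM2l //.
    by rewrite !mulr_ge0 ?invr_ge0 ?exprn_ge0 ?divr_ge0 // ltW.
  have := subrX1 (2^-1 : R) (n - d); set G := \sum_(_ < _) _ => e.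
  have : 0 <= 2^-1 ^+ (n - d) :> R by rewrite exprn_ge0.
  by lra.
apply/ler_addgt0Pr => _ /gt0_complexE[e e0 ->].
have /climP/(_ _ e0)[N _ hN] := ch z zr.
have hm : `|h z - S (maxn N d)| < e%:C := hN (maxn N d) (leq_maxl _ _).
rewrite -(big_mkord xpredT (fun k => c k * z ^+ k)) -/(S d).
have -> : h z - S d = (S (maxn N d) - S d) + (h z - S (maxn N d)).
  by rewrite [RHS]addrC [RHS]addrA subrK.
by rewrite (le_trans (ler_normD _ _)) // lerD ?tail ?leq_maxr // ltW.
Qed.

Lemma power_series_ext (r : R) c h1 h2 :
  power_series_on r c h1 -> (forall z, 0 < `|z| < r%:C -> h1 z = h2 z) ->
  power_series_on r c h2.
Proof. by move=> ch e z zr; rewrite -e //; exact: ch. Qed.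

Lemma power_series_shrink (r r' : R) c h : r' <= r ->
  power_series_on r c h -> power_series_on r' c h.
Proof.
move=> rr ch z /andP[z0 zr]; apply: ch.
by rewrite z0 (lt_le_trans zr) // lecR.
Qed.

Lemma power_seriesD (r : R) a b f g : power_series_on r a f ->
  power_series_on r b g ->
  power_series_on r (fun k => a k + b k) (fun z => f z + g z).
Proof.
move=> af bg z zr; apply: clim_eq (climD (af z zr) (bg z zr)) _ => n.
by rewrite /series /= -big_split /=; apply: eq_bigr => k _; rewrite mulrDl.
Qed.

(** With rho strictly between |z| and r, Cauchy estimates at rho dominate both
   series at z by the powers of |z|/rho = q^2. *)
Lemma power_seriesM (r : R) a b f g : power_series_on r a f ->
  power_series_on r b g ->
  power_series_on r (cauchy_coef a b) (fun z => f z * g z).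
Proof.
move=> af bg z zr; have [x /andP[x0 xr] zx] := norm_lt_radius zr.
pose rho := (x + r) / 2; pose q := Num.sqrt (x / rho).
have rho0 : 0 < rho by rewrite /rho; lra.
have xrho : x < rho by rewrite /rho; lra.
have qq : q * q = x / rho by rewrite -expr2 sqr_sqrtr // divr_ge0 // ltW.
have hrho : 0 < rho < r by rewrite rho0 /= /rho; lra.
have [A A0 hA] := power_series_coef_bound af hrho.
have [B B0 hB] := power_series_coef_bound bg hrho.
have term (D : R) (a0 : nat -> C) : 0 <= D ->
    (forall k, `|a0 k| <= (D * rho ^- k)%:C) ->
    forall k, `|a0 k * z ^+ k| <= (D * (q * q) ^+ k)%:C.
  move=> D0 ha k; rewrite normrM normrX zx qq.
  apply: (@le_trans _ _ ((D * rho ^- k)%:C * (x ^+ k)%:C)).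
    by rewrite realcX ler_wpM2r // exprn_ge0 // ler0c ltW.
  by rewrite -realcM lecR [leRHS](_ : _ = D * rho ^- k * x ^+ k) // expr_div_n; ring.
have q01 : 0 <= q < 1.
  rewrite sqrtr_ge0 /= -(sqrtr1 R) ltr_sqrt // ltr_pdivrMr //.
  by rewrite mul1r.
have := clim_cauchy_product A0 B0 q01 (term _ _ A0 hA) (term _ _ B0 hB)
  (af z zr) (bg z zr).
move=> cab; apply: clim_eq cab _ => n; rewrite /series /=.
apply: eq_bigr => k _; rewrite /cauchy_coef mulr_suml; apply: eq_bigr => i _.
by rewrite mulrACA -exprD subnKC // -ltnS.
Qed.

Lemma power_series_cst (r : R) w :
  power_series_on r (fun k => w *+ (k == 0)%N) (fun=> w).
Proof.
move=> z _; apply: clim_near (clim_cst \oo w) _; exists 1%N => // -[//|n] _ /=.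
rewrite /series /= big_nat_recl //= mulr1n mulr1 big1 ?addr0 // => i _.
by rewrite mul0r.
Qed.

Lemma power_seriesX (r : R) c h m : power_series_on r c h ->
  power_series_on r (fun k => if (k < m)%N then 0 else c (k - m)%N)
    (fun z => z ^+ m * h z).
Proof.
move=> ch z zr.
have hl := (climP _ _).1 (climM (clim_cst \oo (z ^+ m)) (ch z zr)).
apply/climP => e /hl[N _ hN]; exists (N + m)%N => // n /= Nn.
have mn : (m <= n)%N by rewrite (leq_trans _ Nn) // leq_addl.
have := hN (n - m)%N; rewrite /= leq_subRL // addnC => /(_ Nn).
congr (`|_ - _| < _); rewrite /series /= [RHS](big_cat_nat (n := m)) //=.
rewrite [X in _ = X + _]big_nat_cond [X in _ = X + _]big1 ?add0r; last first.
  by move=> i /andP[/andP[_ im] _]; rewrite im mul0r.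
rewrite -[X in index_iota X n]add0n big_addn mulr_sumr; apply: eq_bigr => i _.
by rewrite ltnNge leq_addl /= addnK exprD mulrCA [z ^+ m * _]mulrC.
Qed.

Lemma power_series_scale (r : R) (t : nat) c h : (0 < t)%N ->
  power_series_on r c h ->
  power_series_on (r / t%:R) (fun k => c k * t%:R ^+ k) (fun z => h (t%:R * z)).
Proof.
move=> t0 ch z zr.
have tz : 0 < `|t%:R * z| < r%:C.
  rewrite normrM normr_nat; move: zr => /andP[z0 zr].
  rewrite mulr_gt0 ?ltr0n //=.
  rewrite mulrC -ltr_pdivlMr ?ltr0n //; move: zr.
  by rewrite realcM realcV realc_nat.
apply: clim_eq (ch _ tz) _ => n; rewrite /series /=.
by apply: eq_bigr => k _; rewrite exprMn mulrA.
Qed.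

(** A first nonzero term would dominate the remainder at small positive
   arguments. *)
Lemma power_series_eq0 (r eps : R) c h : 0 < r -> 0 < eps ->
  power_series_on r c h -> (forall x : R, 0 < x < eps -> h x%:C = 0) ->
  forall k, c k = 0.
Proof.
move=> r0 eps0 ch h0 k; elim/ltn_ind: k => k IH.
have [B B0 hB] := power_series_remainder k.+1 r0 ch.
have small (x : R) : 0 < x < eps -> x < r / 4 ->
    complex.Re `|c k| <= B * x.
  move=> /andP[x0 xe] xr; have xC : `|x%:C| = x%:C by rewrite normc_nneg ?ltW.
  have := hB x%:C; rewrite xC !ltcR x0 xr => /(_ isT).
  rewrite h0 ?x0 // sub0r normrN big_ord_recr /= big1 ?add0r; last first.
    by move=> i _; rewrite IH ?mul0r.
  rewrite normrM normrX xC exprSr mulrA [B%:C * _]mulrC -mulrA mulrC.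
  rewrite ler_pM2l ?exprn_gt0 ?ltcR //.
  by rewrite (normc_real (c k)) -realcM lecR.
apply/eqP; rewrite -normr_eq0 normc_real.
set a := complex.Re _ in small *.
have a0 : 0 <= a by rewrite -ler0c -normc_real.
have [/eqP -> //|an0] := boolP (a == 0).
have ap : 0 < a by rewrite lt0r an0.
(* x <= a / (2 (B + 1)) contradicts a <= B x *)
pose x := Num.min (eps / 2) (Num.min (r / 8) (a / (2 * (B + 1)))).
have x0 : 0 < x by rewrite !lt_min !divr_gt0 //; lra.
have xe : x <= eps / 2 by rewrite ge_min lexx.
have xr : x <= r / 8 by rewrite !ge_min lexx orbT.
have xa : x <= a / (2 * (B + 1)) by rewrite !ge_min lexx !orbT.
have aBx : a <= B * x by apply: small; [rewrite x0 /=|]; lra.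
have : x * (2 * (B + 1)) <= a by rewrite -ler_pdivlMr //; lra.
by nra.
Qed.

End PowerSeries.

(** * The complex exponential *)

Section ComplexExponential.
Context {R : realType}.
Local Notation C := R[i].
Implicit Types (z w : C) (x y : R).

Definition cexp w : C :=
  (expR (complex.Re w))%:C * (cos (complex.Im w) +i* sin (complex.Im w)).

Lemma complex_ext z w : complex.Re z = complex.Re w ->
  complex.Im z = complex.Im w -> z = w.
Proof. by case: z w => a b [c d] /= -> ->. Qed.

Lemma cpowE x z : cpow x z = cexp (z * (ln x)%:C).
Proof.
by case: z => a b; rewrite /cpow /cexp /= !mulr0 subr0 add0r.
Qed.

Lemma cexpD z w : cexp (z + w) = cexp z * cexp w.
Proof.
case: z w => a b [c d]; rewrite /cexp /= expRD cosD sinD realcM mulrACA.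
congr (_ * _); congr (_ +i* _); exact: addrC.
Qed.

Lemma cexp0 : cexp 0 = 1.
Proof. by rewrite /cexp /= expR0 cos0 sin0 mul1r. Qed.

Lemma cexpMn z n : cexp (z *+ n) = cexp z ^+ n.
Proof.
by elim: n => [|n IH]; rewrite ?cexp0 // mulrS cexpD IH exprS.
Qed.

Lemma clim_realc (v : nat -> R) x : v @ \oo --> x ->
  clim \oo (fun n => (v n)%:C) x%:C.
Proof. by move=> vx; apply: clim_complex => //=; exact: cvg_cst. Qed.

Lemma clim_exp_real x :
  clim \oo (series (fun k => x%:C ^+ k / k`!%:R)) (expR x)%:C.
Proof.
apply: clim_eq (clim_realc (is_cvg_series_exp_coeff x)) _ => n.
rewrite /series /= rmorph_sum; apply: eq_bigr => k _.
by rewrite /exp_coeff /= realcM realcV realcX realc_nat.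
Qed.

Lemma imaginary_exp_coef x k :
  (0 +i* x) ^+ k / k`!%:R = cos_coeff x k +i* sin_coeff x k :> C.
Proof.
have -> : 0 +i* x = 'i%C * x%:C :> C.
  by apply: complex_ext => /=; ring.
have -> : ('i%C * x%:C) ^+ k = 'i%C ^+ odd k * ((-1) ^+ k./2)%:C * x%:C ^+ k :> C.
  rewrite exprMn -[in 'i%C ^+ k](odd_double_half k) exprD -mul2n exprM sqr_i.
  by rewrite realcX rmorphN1.
rewrite -realcX -realc_nat -realcV -mulrA -mulrA -!realcM.
rewrite /cos_coeff /sin_coeff /=.
case: (boolP (odd k)) => ok /=.
  have -> : k.-1./2 = k./2 by case: k ok => //= k; rewrite uphalf_half => /negbTE ->.
  by apply: complex_ext => /=; ring.
by apply: complex_ext; rewrite /= -?exprnP; ring.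
Qed.

Lemma clim_exp_imaginary x :
  clim \oo (series (fun k => (0 +i* x) ^+ k / k`!%:R)) (cos x +i* sin x).
Proof.
have e n : series (fun k => (0 +i* x) ^+ k / k`!%:R) n =
    series (cos_coeff x) n +i* series (sin_coeff x) n :> C.
  elim: n => [|n IH]; first by rewrite /series /= !big_geq.
  move: IH; rewrite /series /= !big_nat_recr //= => ->.
  by rewrite imaginary_exp_coef.
apply: clim_complex.
  under eq_fun do rewrite e; rewrite /= cos.unlock; exact: is_cvg_series_cos_coeff.
under eq_fun do rewrite e; rewrite /= sin.unlock; exact: is_cvg_series_sin_coeff.
Qed.

(** The series of exp(4|w|) converges; the ratio is written as a square to fit
   the Cauchy product. *)
Lemma exp_coef_bound w :
  exists2 M : R, 0 <= M & forall k, `|w ^+ k / k`!%:R| <= (M * (2^-1 * 2^-1) ^+ k)%:C.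
Proof.
pose y := complex.Re `|w|.
have y0 : 0 <= y by rewrite -ler0c -normc_real.
have [M M0 hM] := clim_bounded (clim_realc (cvg_exp_coeff (4 * y))).
exists M => // k.
have f0 : 0 < (k`!%:R : R) by rewrite ltr0n fact_gt0.
have h : (4 * y) ^+ k / k`!%:R <= M.
  rewrite -lecR -normc_nneg; first exact: (hM k).
  by rewrite divr_ge0 ?exprn_ge0 ?mulr_ge0 // ltW.
rewrite normrM normrX normfV normr_nat normc_real -/y.
rewrite -realc_nat -realcV -realcX -realcM lecR.
have -> : y ^+ k / k`!%:R = (4 * y) ^+ k / k`!%:R * (2^-1 * 2^-1) ^+ k.
  rewrite mulrAC -exprMn; congr (_ ^+ _ / _); lra.
by rewrite ler_wpM2r // exprn_ge0 // mulr_ge0.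
Qed.

(** By the binomial formula the exponential series at a + ib is the Cauchy
   product of those at a and ib, which are known from real analysis. *)
Lemma clim_cexp w : clim \oo (series (fun k => w ^+ k / k`!%:R)) (cexp w).
Proof.
case: w => a b.
have [A A0 hA] := exp_coef_bound a%:C.
have [B B0 hB] := exp_coef_bound (0 +i* b).
have q01 : 0 <= (2^-1 : R) < 1 by lra.
have h := clim_cauchy_product A0 B0 q01 hA hB (clim_exp_real a) (clim_exp_imaginary b).
apply: clim_eq h _ => n; rewrite /series /=; apply: eq_bigr => k _.
have -> : a +i* b = a%:C + (0 +i* b).
  by apply: complex_ext => /=; ring.
rewrite addrC exprDn mulr_suml; apply: eq_bigr => i _.
have ik : (i <= k)%N by rewrite -ltnS.
rewrite -mulr_natr mulrAC -(bin_fact ik) !natrM.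
have h1 : (i`!%:R : C) != 0 by rewrite pnatr_eq0 -lt0n fact_gt0.
have h2 : ((k - i)`!%:R : C) != 0 by rewrite pnatr_eq0 -lt0n fact_gt0.
have h3 : ('C(k, i)%:R : C) != 0 by rewrite pnatr_eq0 -lt0n bin_gt0.
by field; rewrite h1 h2.
Qed.

Lemma power_series_cexp (r : R) (t : C) :
  power_series_on r (fun k => t ^+ k / k`!%:R) (fun z => cexp (t * z)).
Proof.
move=> z _; apply: clim_eq (clim_cexp (t * z)) _ => n; rewrite /series /=.
by apply: eq_bigr => k _; rewrite exprMn mulrAC.
Qed.

End ComplexExponential.

(** * Laurent expansions *)

Section Laurent.
Context {R : realType}.
Local Notation C := R[i].
Implicit Types (z w : C) (F G : C -> C) (r : R) (c : nat -> C).

Lemma laurentP N c r G :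
  laurent N c r G <-> power_series_on r c (fun z => z ^+ N * G z).
Proof.
split=> h z zr; have z0 : z != 0 by move: zr => /andP[]; rewrite normr_gt0.
  apply: clim_eq (climM (clim_cst \oo (z ^+ N)) (Clim (h z zr))) _ => n.
  rewrite /series /= mulr_sumr; apply: eq_bigr => k _.
  by rewrite mulrCA !exprnP -expfzDr // addrC subrK.
have [] : clim \oo (series (fun k => c k * z ^ (k%:Z - N%:Z))) (G z).
  have -> : G z = z ^- N * (z ^+ N * G z) by rewrite mulKf // expf_neq0.
  apply: clim_eq (climM (clim_cst \oo (z ^- N)) (h z zr)) _ => n.
  rewrite /series /= mulr_sumr; apply: eq_bigr => k _.
  by rewrite mulrCA exprnN exprnP -expfzDr // addrC.
exact.
Qed.

Definition meromorphic_on r G : Prop := exists N c, laurent N c r G.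

Lemma meromorphic_ext r F G : meromorphic_on r F ->
  (forall z, 0 < `|z| < r%:C -> F z = G z) -> meromorphic_on r G.
Proof.
move=> [N [c /laurentP h]] e; exists N, c; apply/laurentP.
by apply: (power_series_ext h) => z zr; rewrite e.
Qed.

Lemma meromorphic_shrink r r' G : r' <= r ->
  meromorphic_on r G -> meromorphic_on r' G.
Proof.
move=> rr [N [c /laurentP h]]; exists N, c; apply/laurentP.
exact: power_series_shrink h.
Qed.

Lemma meromorphic_cst r w : meromorphic_on r (fun=> w).
Proof.
exists 0%N, (fun k => w *+ (k == 0)%N); apply/laurentP.
by apply: (power_series_ext (@power_series_cst R r w)) => z _; rewrite mul1r.
Qed.

Lemma meromorphicD r F G : meromorphic_on r F -> meromorphic_on r G ->
  meromorphic_on r (fun z => F z + G z).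
Proof.
move=> [N [a /laurentP ha]] [M [b /laurentP hb]].
exists (M + N)%N; eexists; apply/laurentP.
apply: (power_series_ext (power_seriesD (power_seriesX M ha) (power_seriesX N hb))).
by move=> z _; rewrite !mulrA -!exprD [(N + M)%N]addnC mulrDr.
Qed.

Lemma meromorphicM r F G : meromorphic_on r F -> meromorphic_on r G ->
  meromorphic_on r (fun z => F z * G z).
Proof.
move=> [N [a /laurentP ha]] [M [b /laurentP hb]].
exists (N + M)%N; eexists; apply/laurentP.
apply: (power_series_ext (power_seriesM ha hb)).
by move=> z _; rewrite exprD mulrACA.
Qed.

Lemma meromorphic_sum r (I : Type) (s : seq I) (F : I -> C -> C) :
  (forall i, meromorphic_on r (F i)) ->
  meromorphic_on r (fun z => \sum_(i <- s) F i z).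
Proof.
move=> hF; elim: s => [|i s IH].
  by apply: (meromorphic_ext (meromorphic_cst r 0)) => z _; rewrite big_nil.
by apply: (meromorphic_ext (meromorphicD (hF i) IH)) => z _; rewrite big_cons.
Qed.

Lemma meromorphic_cexp r w : meromorphic_on r (fun z => cexp (w * z)).
Proof.
exists 0%N; eexists; apply/laurentP.
by apply: (power_series_ext (@power_series_cexp R r w)) => z _; rewrite mul1r.
Qed.

Lemma meromorphic_scale r (t : nat) G : (0 < t)%N ->
  meromorphic_on r G -> meromorphic_on (r / t%:R) (fun z => G (t%:R * z)).
Proof.
move=> t0 [N [c /laurentP h]].
have h1 := power_seriesM (power_series_scale t0 h)
  (@power_series_cst R (r / t%:R) (t%:R ^- N)).
exists N; eexists; apply/laurentP; apply: (power_series_ext h1) => z _.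
by rewrite exprMn mulrC !mulrA mulVf ?mul1r // expf_neq0 // pnatr_eq0 -lt0n.
Qed.

(** Identity theorem: multiplied by a power of z, the difference is a power
   series that vanishes on a real interval ending at 0. *)
Lemma meromorphic_eq r eps F G : 0 < r -> 0 < eps ->
  meromorphic_on r F -> meromorphic_on r G ->
  (forall x : R, 0 < x < eps -> F x%:C = G x%:C) ->
  forall z, 0 < `|z| < r%:C -> F z = G z.
Proof.
move=> r0 eps0 hF hG FG z zr; apply/eqP; rewrite -subr_eq0; apply/eqP.
have [N [c /laurentP h]] := meromorphicD hF (meromorphicM (meromorphic_cst r (-1)) hG).
have c0 := power_series_eq0 r0 eps0 h.
have {}c0 : forall k, c k = 0.
  by apply: c0 => x xe; rewrite FG // mulN1r subrr mulr0.
have zN : z ^+ N != 0 by rewrite expf_neq0 // -normr_gt0; case/andP: zr.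
have h0 : clim \oo (series (fun k => c k * z ^+ k)) 0.
  apply: clim_eq (clim_cst \oo 0) _ => n.
  by rewrite /series /= big1 // => k _; rewrite c0 mul0r.
have e := clim_unique (h z zr) h0.
by apply: (mulfI zN); rewrite mulr0 -e mulN1r.
Qed.

End Laurent.

(** * The polynomial model of the toy rules *)

Section PolyLift.
Context {K : comNzRingType} {V : lmodType K}.
Implicit Types (h : nat -> V) (P : {poly K}).

Definition poly_lift h P : V := \sum_(i < size P) P`_i *: h i.

Lemma poly_lift_wide h P n : (size P <= n)%N ->
  poly_lift h P = \sum_(i < n) P`_i *: h i.
Proof.
move=> Pn; rewrite /poly_lift (big_ord_widen _ (fun i => P`_i *: h i) Pn).
rewrite big_mkcond; apply: eq_bigr => i _; case: ltnP => // Pi.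
by rewrite nth_default // scale0r.
Qed.

Lemma poly_lift_is_linear h : linear (poly_lift h).
Proof.
move=> a P Q; pose n := maxn (size (a *: P + Q)) (maxn (size P) (size Q)).
rewrite !(@poly_lift_wide _ _ n) ?leq_max ?leqnn ?orbT //.
rewrite scaler_sumr -big_split /=; apply: eq_bigr => i _.
by rewrite coefD coefZ scalerDl scalerA.
Qed.

HB.instance Definition _ h :=
  GRing.isLinear.Build K {poly K} V _ (poly_lift h) (poly_lift_is_linear h).

Lemma poly_liftXn h n : poly_lift h 'X^n = h n.
Proof.
rewrite (@poly_lift_wide _ _ n.+1) ?size_polyXn // big_ord_recr /= big1 ?add0r.
  by rewrite coefXn eqxx scale1r.
by move=> i _; rewrite coefXn ltn_eqF // scale0r.
Qed.

Lemma poly_linear_ext (f1 f2 : {poly K} -> V) : linear f1 -> linear f2 ->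
  (forall n, f1 'X^n = f2 'X^n) -> f1 =1 f2.
Proof.
move=> l1 l2 e P.
pose F1 := HB.pack f1 (GRing.isLinear.Build _ _ _ _ f1 l1) : {linear {poly K} -> V}.
pose F2 := HB.pack f2 (GRing.isLinear.Build _ _ _ _ f2 l2) : {linear {poly K} -> V}.
have : F1 P = F2 P; last by [].
rewrite -[P]coefK poly_def !linear_sum; apply: eq_bigr => i _.
by rewrite !linearZ /= e.
Qed.

End PolyLift.

Lemma monoid_morphism_comp (A B D : pzSemiRingType) (f : B -> D) (h : A -> B) :
  monoid_morphism f -> monoid_morphism h -> monoid_morphism (f \o h).
Proof.
by move=> [f1 fM] [h1 hM]; split=> [|x y] /=; rewrite ?h1 ?f1 // hM fM.
Qed.

Section ToyPolynomials.
Local Notation conv := Defs.conv.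
Context {K : comNzRingType}.
Implicit Types (w : nat -> K) (g : HR K) (P : {poly K}).

(** B_+ in the polynomial model: putting a root below a forest with i vertices
   adds one vertex and contributes the weight w i. *)
Definition graft_op w : {poly K} -> {poly K} :=
  poly_lift (fun i => w i *: 'X^(i.+1)).

HB.instance Definition _ w :=
  GRing.Linear.copy (graft_op w) (poly_lift (fun i => w i *: 'X^(i.+1))).

Lemma coef_graft_op w P i :
  (graft_op w P)`_i = if i is j.+1 then P`_j * w j else 0.
Proof.
rewrite /graft_op (@poly_lift_wide _ _ _ _ (maxn (size P) i)) ?leq_maxl //.
rewrite coef_sum; case: i => [|j].
  by rewrite big1 // => i _; rewrite !coefZ coefXn /= !mulr0.
have jn : (j < maxn (size P) j.+1)%N by rewrite leq_max leqnn orbT.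
rewrite (bigD1 (Ordinal jn)) //= !coefZ coefXn eqxx mulr1 big1 ?addr0 // => i ij.
rewrite !coefZ coefXn eqSS; case: eqP => [e|]; last by rewrite !mulr0.
by case/eqP: ij; apply/val_inj.
Qed.

Lemma size_graft_op w P : (size (graft_op w P) <= (size P).+1)%N.
Proof.
apply/leq_sizeP => -[|j] Pj; rewrite coef_graft_op //.
by rewrite nth_default ?mul0r.
Qed.

Fixpoint tree_poly w (t : ptree) : {poly K} :=
  let: PNode l := t in graft_op w (\prod_(x <- map (tree_poly w) l) x).

(** A forest with n vertices is sent to a multiple of X^n; evaluation at
   X = s^(-z) gives the rules at s. *)
Definition toy_poly w : HR K -> {poly K} :=
  alg_lift (fun t => tree_poly w (val t)).

Lemma toy_poly_linear w : linear (toy_poly w).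
Proof. by move=> a x y; rewrite /toy_poly linearP. Qed.

Lemma toy_poly_morph w : monoid_morphism (toy_poly w).
Proof. exact: alg_lift_morph. Qed.

Lemma toy_poly_Bplus w g : toy_poly w (Bplus g) = graft_op w (toy_poly w g).
Proof.
move: g; apply: basis_ext => [a x y|a x y|m].
- by rewrite Bplus_linear toy_poly_linear.
- by rewrite toy_poly_linear linearP.
rewrite -tree_eltE; transitivity (tree_poly w (forest_node m)).
  exact: alg_liftE.
transitivity (graft_op w
  (\prod_(x <- map (tree_poly w) (pchildren (forest_node m))) x)); first exact: erefl.
by rewrite prod_children; congr graft_op; apply/esym; exact: basis_liftU.
Qed.

(** Every tree is B_+ of the product of its branches, so that HR is generated by
   1 under linear combinations, products and B_+. *)
Lemma HR_ind (Pr : HR K -> Prop) : Pr 1 ->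
  (forall a x y, Pr x -> Pr y -> Pr (a *: x + y)) ->
  (forall x y, Pr x -> Pr y -> Pr (x * y)) ->
  (forall x, Pr x -> Pr (Bplus x)) -> forall g, Pr g.
Proof.
move=> P1 PD PM PB.
have P0 : Pr 0 by rewrite -(addNr 1) -scaleN1r; exact: PD.
have Pforest (m : forest) : 
    (forall t, t \in finsupp m -> Pr (tree_elt t)) -> Pr (<< m >> : HR K).
  move=> Pt; rewrite forestE big_seq; apply: big_rec => // t x.
  by rewrite mem_forest_seq => /Pt; exact: PM.
have Ptree t : Pr (tree_elt t).
  elim/rtree_graft_ind: t => m IH; rewrite tree_eltE.
  by apply: PB; exact: Pforest.
move=> g; rewrite (malg_basisE g); apply: (big_rec Pr P0) => m x _ Px.
by apply: PD (Pforest m _) Px => t _; exact: Ptree.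
Qed.

(** The summand B_+ (x) 1 of the coproduct contributes the counterterm; in the
   other summand B_+ acts on the second factor, where it becomes the linear map
   [graft_op]. *)
Lemma conv_graft_op w (Z : HR K -> K) g : scalar Z ->
  conv (polyC \o Z) (toy_poly w) (Bplus g) =
  polyC (Z (Bplus g)) + graft_op w (conv (polyC \o Z) (toy_poly w) g).
Proof.
move=> lZ; have lZP : linear (polyC \o Z).
  by move=> a x y /=; rewrite lZ polyCD polyCM mul_polyC.
rewrite (conv_Bplus g lZP (@toy_poly_linear w) (toy_poly_morph w).1).
congr (_ + _); rewrite /conv /=; move: (coproduct g).
apply: basis_ext => [a x y|a x y|p].
- by rewrite tens_mul_linear.
- by rewrite tens_mul_linear linearP.
by rewrite !tens_mulU /= toy_poly_Bplus !mul_polyC linearZ.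
Qed.

Lemma horner_conv w (Z : HR K -> K^o) g x :
  (conv (polyC \o Z) (toy_poly w) g).[x] =
  conv Z (fun y => (toy_poly w y).[x] : K^o) g.
Proof.
pose f1 (t : HR2 K) : K^o := (tens_mul (polyC \o Z) (toy_poly w) t).[x].
pose f2 (t : HR2 K) := tens_mul Z (fun y => (toy_poly w y).[x] : K^o) t.
suff : f1 =1 f2 by apply.
apply: basis_ext => [a u v|a u v|p].
- by rewrite /f1 tens_mul_linear hornerD hornerZ.
- by rewrite /f2 tens_mul_linear.
by rewrite /f1 /f2 !tens_mulU hornerM hornerC.
Qed.

(** A character turns the identity S * id = counit of linear maps on HR into an
   identity of convolutions with values in A. *)
Lemma conv_comp_antipode (A : comAlgType K) (f : HR K -> A) g :
  linear f -> monoid_morphism f -> conv (f \o antipode) f g = counit g *: 1.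
Proof.
move=> lf [f1 fM]; transitivity (f (conv antipode id g)).
  rewrite /conv /=; move: (coproduct g); apply: basis_ext => [a u v|a u v|p].
  - by rewrite tens_mul_linear.
  - by rewrite tens_mul_linear lf.
  by rewrite !tens_mulU fM.
rewrite antipode_left /unit_counit -f1.
have f0 : f 0 = 0 by have := lf (-1) 0 0; rewrite scaler0 addr0 scaleN1r addNr.
by have := lf (counit g) 1 0; rewrite f0 !addr0.
Qed.

End ToyPolynomials.

(** * Integrals and powers on the positive reals *)

Section ComplexIntegral.
Context {R : realType}.
Local Notation C := R[i].
Local Notation pos := (posreal : set R).
Implicit Types (F G : R -> C) (w : C).

Let mpos : measurable (pos : set (measurableTypeR R)).
Proof. exact: measurable_itv. Qed.

Lemma posrealP (x : R) : (x \in pos) = (0 < x).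
Proof. by apply/idP/idP; rewrite inE /posreal /= in_itv /= andbT. Qed.

Lemma eq_cintegral F G : (forall x, 0 < x -> F x = G x) ->
  cintegral pos F = cintegral pos G.
Proof.
move=> FG; rewrite /cintegral; congr (_ +i* _);
  by apply: eq_Rintegral => x; rewrite posrealP => /FG ->.
Qed.

Lemma eq_cintegrable F G : (forall x, 0 < x -> F x = G x) ->
  cintegrable pos F -> cintegrable pos G.
Proof.
move=> FG [h1 h2]; split.
  by apply: (eq_integrable mpos _ _ _ h1) => x; rewrite posrealP => /FG ->.
by apply: (eq_integrable mpos _ _ _ h2) => x; rewrite posrealP => /FG ->.
Qed.

Lemma cintegrableD F G : cintegrable pos F -> cintegrable pos G ->
  cintegrable pos (fun x => F x + G x).
Proof.
move=> [f1 f2] [g1 g2]; split.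
  apply: (eq_integrable mpos _ _ _ (integrableD mpos f1 g1)) => x _.
  by case: (F x) (G x) => a b [c d].
apply: (eq_integrable mpos _ _ _ (integrableD mpos f2 g2)) => x _.
by case: (F x) (G x) => a b [c d].
Qed.

Lemma cintegralD F G : cintegrable pos F -> cintegrable pos G ->
  cintegral pos (fun x => F x + G x) = cintegral pos F + cintegral pos G.
Proof.
move=> [f1 f2] [g1 g2]; apply: complex_ext => /=.
  rewrite -RintegralD //; apply: eq_Rintegral => x _.
  by case: (F x) (G x) => a b [c d].
rewrite -RintegralD //; apply: eq_Rintegral => x _.
by case: (F x) (G x) => a b [c d].
Qed.

Lemma cintegrableZ w F : cintegrable pos F ->
  cintegrable pos (fun x => w * F x).
Proof.
case: w => a b [f1 f2]; split.
  apply: (eq_integrable mpos _ _ _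
    (integrableB mpos (integrableZl mpos a f1) (integrableZl mpos b f2))) => x _.
  by case: (F x) => c d.
apply: (eq_integrable mpos _ _ _
  (integrableD mpos (integrableZl mpos a f2) (integrableZl mpos b f1))) => x _.
by case: (F x) => c d.
Qed.

Lemma cintegralZ w F : cintegrable pos F ->
  cintegral pos (fun x => w * F x) = w * cintegral pos F.
Proof.
case: w => a b [f1 f2]; apply: complex_ext => /=.
  rewrite -!RintegralZl // -RintegralB //; last 2 first.
  - exact: (integrableZl mpos a f1).
  - exact: (integrableZl mpos b f2).
  by apply: eq_Rintegral => x _; case: (F x).
rewrite -!RintegralZl // -RintegralD //; last 2 first.
- exact: (integrableZl mpos a f2).
- exact: (integrableZl mpos b f1).
by apply: eq_Rintegral => x _; case: (F x).
Qed.

Lemma cintegral_sum n (F : nat -> R -> C) (a : nat -> C) :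
  (forall i, (i < n)%N -> cintegrable pos (F i)) ->
  cintegrable pos (fun x => \sum_(i < n) a i * F i x) /\
  cintegral pos (fun x => \sum_(i < n) a i * F i x) =
    \sum_(i < n) a i * cintegral pos (F i).
Proof.
elim: n => [_|n IH hF].
  have e x : 0 < x -> 0 * 0 = \sum_(i < 0) a i * F i x by rewrite big_ord0 mul0r.
  have i0 : cintegrable pos (fun=> 0).
    by split; exact: integrable0.
  split; first exact: eq_cintegrable e (cintegrableZ 0 i0).
  by rewrite -(eq_cintegral e) cintegralZ // big_ord0 mul0r.
have [h1 h2] := IH (fun i hi => hF i (ltnW hi)).
have e x : 0 < x -> \sum_(i < n) a i * F i x + a n * F n x =
    \sum_(i < n.+1) a i * F i x by rewrite big_ord_recr.
have hn := cintegrableZ (a n) (hF n (ltnSn n)).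
split; first exact: eq_cintegrable e (cintegrableD h1 hn).
by rewrite -(eq_cintegral e) cintegralD // cintegralZ ?h2 ?big_ord_recr //; exact: hF.
Qed.

End ComplexIntegral.

Section CPow.
Context {R : realType}.
Implicit Types (x y : R) (z w : R[i]).

Lemma cpowM x y z : 0 < x -> 0 < y -> cpow (x * y) z = cpow x z * cpow y z.
Proof. by move=> x0 y0; rewrite !cpowE -cexpD lnM // realcD mulrDr. Qed.

Lemma cpowX x z n : cpow x z ^+ n = cpow x (n%:R * z).
Proof. by rewrite !cpowE -cexpMn -mulrA mulr_natl. Qed.

Lemma cpow_div x y z : 0 < x -> 0 < y -> cpow x z = cpow y z * cpow (x / y) z.
Proof. by move=> x0 y0; rewrite -cpowM ?divr_gt0 // mulrC divfK // gt_eqF. Qed.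

End CPow.

Section Degree.
Context {K : comNzRingType}.

Lemma size_toy_poly (g : HR K) :
  exists N, forall w, (size (toy_poly w g) <= N)%N.
Proof.
move: g; apply: HR_ind => [|a x y [N hN] [M hM]|x y [N hN] [M hM]|x [N hN]].
- by exists 1%N => w; rewrite (toy_poly_morph w).1 size_poly1.
- exists (maxn N M) => w; rewrite toy_poly_linear.
  rewrite (leq_trans (size_polyD _ _)) // geq_max leq_max.
  by rewrite (leq_trans (size_scale_leq _ _) (hN w)) leq_max hM orbT.
- exists (N + M)%N => w; rewrite (toy_poly_morph w).2.
  rewrite (leq_trans (size_polyMleq _ _)) //.
  by rewrite (leq_trans (leq_pred _)) // leq_add.
by exists N.+1 => w; rewrite toy_poly_Bplus (leq_trans (size_graft_op _ _)) ?ltnS.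
Qed.

End Degree.

(** * Existence and uniqueness of the regularized rules *)

Section ToyRules.
Context {R : realType}.
Local Notation C := R[i].
Implicit Types (s mu delta r : R) (z : C) (g : HR C).

(** The strip and the disc overlap but neither contains the other: the recursion
   over the roots takes place on a strip, the continuation on a disc. *)
Definition mellin_extension (f : R -> C) delta r (G : C -> C) : Prop :=
  [/\ 0 < delta, 0 < r, exists c, laurent 1 c r G &
    forall z, 0 < complex.Re z < delta ->
      cintegrable posreal (fun x => f x * cpow x (- z)) /\
      G z = cintegral posreal (fun x => f x * cpow x (- z))].

Lemma admissible_mellin_extension f : admissible f ->
  exists delta r G, mellin_extension f delta r G.
Proof.
case=> _ _ [delta [delta0 fint [G [r [r0 [c [r1 [r10 _ Gc]]] GE]]]]].
exists delta, (Num.min r r1), (fun z => if 0 < complex.Re z < delta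
  then cintegral posreal (fun x => f x * cpow x (- z)) else G z).
split=> //; first by rewrite lt_min r0.
  exists c => z /andP[z0 zr].
  have [zr0 zr1] : `|z| < r%:C /\ `|z| < r1%:C.
    by split; apply: lt_le_trans zr _; rewrite lecR ge_min lexx ?orbT.
  case: ifPn => [zd|_]; first by rewrite -GE //; apply: Gc; rewrite z0.
  by apply: Gc; rewrite z0.
by move=> z zd; rewrite zd; split=> //; exact: fint.
Qed.

Definition toy_weights (G : C -> C) z (i : nat) : C := G (i.+1%:R * z).

Definition toy_rules G s z g : C :=
  (toy_poly (toy_weights G z) g).[cpow s (- z)].

Lemma toy_rules_scalar G s z : scalar (toy_rules G s z).
Proof.
by move=> a x y; rewrite /toy_rules toy_poly_linear hornerD hornerZ.
Qed.

Lemma toy_rules_morph G s z : monoid_morphism (toy_rules G s z).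
Proof.
have [t1 tM] := toy_poly_morph (toy_weights G z).
split=> [|x y]; first by rewrite /toy_rules t1 hornerC.
by rewrite /toy_rules tM hornerM.
Qed.

Section Extension.
Context {f : R -> C} {delta r : R} {G : C -> C}.
Context (hG : mellin_extension f delta r G).

Let min_lel (a b : R) : Num.min a b <= a.
Proof. by rewrite ge_min lexx. Qed.

Let min_ler (a b : R) : Num.min a b <= b.
Proof. by rewrite ge_min lexx orbT. Qed.

Lemma Re_natmul n z : complex.Re (n%:R * z) = n%:R * complex.Re z.
Proof. by rewrite -realc_nat; case: z => a b /=; rewrite mul0r subr0. Qed.

(** In degree i the rules at s x are those at s multiplied by x^(-iz), so that
   integrating over the new root x yields the Mellin transform at (i+1)z. The
   bound eps keeps all these arguments in the strip of convergence. *)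
Lemma toy_rules_Bplus g : exists2 eps : R, 0 < eps &
  forall s z, 0 < s -> 0 < complex.Re z < eps ->
    let F x := cpow (s * x) (- z) * f x * toy_rules G (s * x) z g in
    cintegrable posreal F /\ toy_rules G s z (Bplus g) = cintegral posreal F.
Proof.
case: hG => delta0 r0 _ GE; have [N hN] := size_toy_poly g.
exists (delta / N.+1%:R) => [|s z s0 zd F]; first by rewrite divr_gt0 // ltr0n.
set P := toy_poly (toy_weights G z) g.
have PN : (size P <= N)%N by exact: hN.
have zi i : (i < N)%N -> 0 < complex.Re (i.+1%:R * z) < delta.
  move=> iN; rewrite Re_natmul; case/andP: zd => z0 zd.
  rewrite mulr_gt0 ?ltr0n //=; move: zd; rewrite ltr_pdivlMr ?ltr0n // mulrC.
  by apply: le_lt_trans; rewrite ler_wpM2r ?(ltW z0) // ler_nat ltnW.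
have [h1 h2] := cintegral_sum (fun i => P`_i * cpow s (- z) ^+ i.+1)
  (fun i iN => (GE _ (zi i iN)).1).
have e x : 0 < x -> \sum_(i < N) P`_i * cpow s (- z) ^+ i.+1 *
    (f x * cpow x (- (i.+1%:R * z))) = F x.
  move=> x0; rewrite /F /toy_rules -/P (horner_coef_wide _ PN) mulr_sumr.
  apply: eq_bigr => i _; rewrite cpowM // -mulrN -cpowX.
  by move: (cpow s _) (cpow x _) => u v; rewrite exprMn !exprS; ring.
split; first exact: eq_cintegrable e h1.
rewrite -(eq_cintegral e) h2 /toy_rules toy_poly_Bplus -/P.
have PN1 : (size (graft_op (toy_weights G z) P) <= N.+1)%N.
  by rewrite (leq_trans (size_graft_op _ _)).
rewrite (horner_coef_wide _ PN1) big_ord_recl coef_graft_op mul0r add0r.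
apply: eq_bigr => i _; rewrite coef_graft_op lift0 -(GE _ (zi i _)).2 //.
by rewrite mulrAC.
Qed.

(** Only the finitely many dilations F((j+1)z) with j below the degree occur,
   which leaves a common disc for all the coefficients. *)
Lemma toy_poly_meromorphic g : exists2 r' : R, 0 < r' & forall i,
  meromorphic_on r' (fun z => (toy_poly (toy_weights G z) g)`_i).
Proof.
case: hG => delta0 r0 [c Gc] _.
move: g; apply: HR_ind => [|a x y [r1 r10 h1] [r2 r20 h2]|
    x y [r1 r10 h1] [r2 r20 h2]|x [r1 r10 h1]].
- exists 1 => // i; apply: (meromorphic_ext (meromorphic_cst 1 (i == 0)%:R)).
  by move=> z _; rewrite (toy_poly_morph _).1 coef1.
- exists (Num.min r1 r2) => [|i]; first by rewrite lt_min r10.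
  have m1 := meromorphic_shrink (min_lel r1 r2) (h1 i).
  have m2 := meromorphic_shrink (min_ler r1 r2) (h2 i).
  apply: (meromorphic_ext (meromorphicD
    (meromorphicM (meromorphic_cst _ a) m1) m2)) => z _.
  by rewrite toy_poly_linear coefD coefZ.
- exists (Num.min r1 r2) => [|i]; first by rewrite lt_min r10.
  have m1 j := meromorphic_shrink (min_lel r1 r2) (h1 j).
  have m2 j := meromorphic_shrink (min_ler r1 r2) (h2 j).
  apply: (meromorphic_ext (meromorphic_sum _ (fun j : 'I_i.+1 =>
    meromorphicM (m1 j) (m2 (i - j)%N)))) => z _.
  by rewrite (toy_poly_morph _).2 coefM.
have [N hN] := size_toy_poly x.
have rN0 : 0 < r / N.+1%:R by rewrite divr_gt0 // ltr0n.
exists (Num.min r1 (r / N.+1%:R)) => [|i]; first by rewrite lt_min r10.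
case: i => [|j].
  apply: (meromorphic_ext (meromorphic_cst _ 0)) => z _.
  by rewrite toy_poly_Bplus coef_graft_op.
have [Nj|jN] := leqP N j.
  apply: (meromorphic_ext (meromorphic_cst _ 0)) => z _.
  rewrite toy_poly_Bplus coef_graft_op nth_default ?mul0r //.
  exact: leq_trans (hN _) Nj.
have le2 : Num.min r1 (r / N.+1%:R) <= r / j.+1%:R.
  rewrite ge_min; apply/orP; right.
  by rewrite ler_pM2l // lef_pV2 ?posrE ?ltr0n // ler_nat ltnS ltnW.
have m1 := meromorphic_shrink (min_lel r1 (r / N.+1%:R)) (h1 j).
have m2 := meromorphic_shrink le2
   (meromorphic_scale (ltn0Sn j) (ex_intro _ 1%N (ex_intro _ c Gc))).
apply: (meromorphic_ext (meromorphicM m1 m2)) => z _.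
by rewrite toy_poly_Bplus coef_graft_op.
Qed.

Lemma toy_rules_meromorphic g : exists2 r' : R, 0 < r' & forall s, 0 < s ->
  meromorphic_on r' (fun z => toy_rules G s z g).
Proof.
have [r' r'0 h] := toy_poly_meromorphic g; have [N hN] := size_toy_poly g.
exists r' => // s s0.
apply: (meromorphic_ext (meromorphic_sum _ (fun i : 'I_N => meromorphicM (h i)
  (meromorphic_cexp r' (- (i%:R * (ln s)%:C)))))) => z _.
rewrite /toy_rules (horner_coef_wide _ (hN _)); apply: eq_bigr => i _.
by rewrite cpowX cpowE; congr (_ * cexp _); ring.
Qed.

Lemma toy_rules_regularized : regularized_rules f (toy_rules G).
Proof.
split=> [s z _|s z _|g|g].
- exact: toy_rules_scalar.
- exact: toy_rules_morph.
- exact: toy_rules_Bplus.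
exact: toy_rules_meromorphic.
Qed.

Section Uniqueness.
Context {phi : R -> C -> HR C -> C} (hphi : regularized_rules f phi).

(** The integral over the root determines the values on B_+ g from those on g. *)
Lemma rules_unique_strip g : exists2 eps : R, 0 < eps &
  forall s z, 0 < s -> 0 < complex.Re z < eps -> phi s z g = toy_rules G s z g.
Proof.
move: g; apply: HR_ind => [|a x y [r1 r10 h1] [r2 r20 h2]|
    x y [r1 r10 h1] [r2 r20 h2]|x [r1 r10 h1]].
- exists 1 => // s z s0 _.
  by rewrite (rules_morphism hphi z s0).1 (toy_rules_morph _ _ _).1.
- exists (Num.min r1 r2) => [|s z s0 /andP[z0]]; first by rewrite lt_min r10.
  rewrite lt_min => /andP[zr1 zr2].
  by rewrite (rules_linear hphi z s0) toy_rules_scalar h1 ?h2 ?z0.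
- exists (Num.min r1 r2) => [|s z s0 /andP[z0]]; first by rewrite lt_min r10.
  rewrite lt_min => /andP[zr1 zr2].
  by rewrite (rules_morphism hphi z s0).2 (toy_rules_morph _ _ _).2 h1 ?h2 ?z0.
have [r2 r20 h2] := rules_Bplus hphi x.
have [r3 r30 h3] := toy_rules_Bplus x.
exists (Num.min r1 (Num.min r2 r3)) => [|s z s0 /andP[z0]].
  by rewrite !lt_min r10 r20.
rewrite !lt_min => /and3P[zr1 zr2 zr3].
have [|_ ->] := h2 s z s0; first by rewrite z0.
have [|_ ->] := h3 s z s0; first by rewrite z0.
by apply: eq_cintegral => t t0; rewrite h1 ?mulr_gt0 // z0.
Qed.

(** The meromorphic extensions agree because they agree on the strip. The radius
   is the same for all s. *)
Lemma rules_unique g : exists2 r' : R, 0 < r' &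
  forall s z, 0 < s -> 0 < `|z| < r'%:C -> phi s z g = toy_rules G s z g.
Proof.
have [eps eps0 he] := rules_unique_strip g.
have [r1 r10 h1] := rules_meromorphic hphi g.
have [r2 r20 h2] := toy_rules_meromorphic g.
exists (Num.min r1 r2) => [|s z s0 zr]; first by rewrite lt_min r10.
have m1 := meromorphic_shrink (min_lel r1 r2) (h1 s s0).
have m2 := meromorphic_shrink (min_ler r1 r2) (h2 s s0).
have r12 : 0 < Num.min r1 r2 by rewrite lt_min r10.
exact: (meromorphic_eq r12 eps0 m1 m2 (fun x xe => he s x%:C s0 xe)).
Qed.

End Uniqueness.
End Extension.
End ToyRules.

(** * Moments of families of polynomials *)

Section LimitsAt0.
Context {R : realType}.
Local Notation C := R[i].
Local Notation at0 := ((0 : C)^').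
Implicit Types (z w : C) (r : R).

Lemma near_punctured r (Q : C -> Prop) : 0 < r ->
  (forall z, 0 < `|z| < r%:C -> Q z) -> \forall z \near at0, Q z.
Proof.
move=> r0 hQ; near=> z; apply: hQ; apply/andP; split.
  by rewrite normr_gt0; near: z; exact: nbhs_dnbhs_neq.
near: z; apply: dnbhs0_lt; by rewrite ltcR.
Unshelve. all: by end_near.
Qed.

Lemma clim_id0 : clim at0 (fun z => z) 0.
Proof. by split; exact: nbhs_dnbhs. Qed.

Lemma clim_power_series r c h K : 0 < r -> power_series_on r c h ->
  clim at0 (fun z => (h z - \sum_(k < K.+1) c k * z ^+ k) / z ^+ K) 0.
Proof.
move=> r0 ch; have [B B0 hB] := power_series_remainder K.+1 r0 ch.
apply/climP => e e0.
have Be : 0 < Num.min (r / 4) (e / (B + 1)).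
  by rewrite lt_min !divr_gt0 //; lra.
apply: (near_punctured Be) => z zr.
have [x /andP[x0 xr] zx] := norm_lt_radius zr.
move: xr; rewrite lt_min => /andP[xr xe].
have hz := hB z; rewrite zx !ltcR x0 xr in hz; have {}hz := hz isT.
have z0 : z != 0 by rewrite -normr_gt0 zx ltcR.
rewrite sub0r normrN normrM normfV normrX zx ltr_pdivrMr ?exprn_gt0 ?ltcR //.
apply: le_lt_trans hz _; rewrite exprS mulrA ltr_pM2r ?exprn_gt0 ?ltcR //.
rewrite -realcM ltcR; move: xe; rewrite ltr_pdivlMr; last by lra.
by nra.
Qed.

Lemma clim_power_series0 r c h : 0 < r -> power_series_on r c h ->
  clim at0 h (c 0%N).
Proof.
move=> r0 ch; pose proof (climD (clim_power_series 0 r0 ch) (clim_cst at0 (c 0%N))) as h1.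
rewrite add0r in h1; apply: clim_eq h1 _ => z.
by rewrite big_ord1 expr0 divr1 mulr1 subrK.
Qed.

End LimitsAt0.

Section Moments.
Context {R : realType}.
Local Notation C := R[i].
Local Notation at0 := ((0 : C)^').
Implicit Types (z : C) (P Q : {poly C}) (M : nat -> C).

(** The value at y = 1 of (z y d/dy)^j P. *)
Definition moment j z : {poly C} -> C^o :=
  poly_lift (fun i => (i%:R * z) ^+ j : C^o).

Lemma moment_linear j z : linear (moment j z).
Proof. by move=> a P Q; rewrite /moment linearP. Qed.

Lemma moment_wide j z P n : (size P <= n)%N ->
  moment j z P = \sum_(i < n) P`_i * (i%:R * z) ^+ j.
Proof. by move=> Pn; rewrite /moment (poly_lift_wide _ Pn). Qed.

Lemma moment0 z P : moment 0 z P = P.[1].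
Proof.
rewrite (moment_wide _ _ (leqnn _)) horner_coef; apply: eq_bigr => i _.
by rewrite expr1n.
Qed.

(** Leibniz rule; on monomials it is the binomial formula for (nz + mz)^j. *)
Lemma momentM j z P Q : moment j z (P * Q) =
  \sum_(l < j.+1) 'C(j, l)%:R * (moment (j - l) z P * moment l z Q).
Proof.
pose f1 (P : {poly C}) : C^o := moment j z (P * Q).
pose f2 (P : {poly C}) : C^o :=
  \sum_(l < j.+1) 'C(j, l)%:R * (moment (j - l) z P * moment l z Q).
suff : f1 =1 f2 by apply.
apply: poly_linear_ext => [a u v|a u v|n].
- by rewrite /f1 mulrDl -scalerAl moment_linear.
- rewrite /f2 scaler_sumr -big_split /=; apply: eq_bigr => l _.
  rewrite moment_linear mulrDl mulrDr; congr (_ + _).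
  by rewrite -[a *: moment _ _ _]/(a * _) -[RHS]/(a * _); ring.
rewrite {P}/f1 {}/f2.
pose f1 (Q : {poly C}) : C^o := moment j z ('X^n * Q).
pose f2 (Q : {poly C}) : C^o :=
  \sum_(l < j.+1) 'C(j, l)%:R * (moment (j - l) z 'X^n * moment l z Q).
suff : f1 =1 f2 by apply.
apply: poly_linear_ext => [a u v|a u v|m].
- by rewrite /f1 mulrDr -scalerAr moment_linear.
- rewrite /f2 scaler_sumr -big_split /=; apply: eq_bigr => l _.
  rewrite moment_linear !mulrDr; congr (_ + _).
  by rewrite -[a *: moment _ _ _]/(a * _) -[RHS]/(a * _); ring.
rewrite /f1 /f2 -exprD /moment poly_liftXn natrD mulrDl exprDn.
apply: eq_bigr => l _; rewrite !poly_liftXn.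
by rewrite -mulr_natl.
Qed.

(** P z stands for the function sum_n (P z)_n exp(-nxz) of x. Its coefficients
   may have poles of order less than K at z = 0; they cancel in the function
   because they cancel in the moments. *)
Definition regular_family (N K : nat) M (P : C -> {poly C}) : Prop :=
  [/\ forall z, (size (P z) <= N)%N,
    forall i, clim at0 (fun z => z ^+ K * (P z)`_i) 0 &
    forall j, clim at0 (fun z => moment j z (P z)) (M j)].

Lemma regular_family1 : regular_family 1 1 (fun j => (j == 0)%N%:R) (fun=> 1).
Proof.
split=> [z|i|j]; first by rewrite size_poly1.
  pose proof (climM clim_id0 (clim_cst at0 (1 : {poly C})`_i)) as h.
  by rewrite mul0r in h.
apply: clim_eq (clim_cst at0 _) _ => z.
rewrite (@moment_wide _ _ (1 : {poly C}) 1) ?size_poly1 //.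
by rewrite big_ord1 mul0r expr0n coef1 mul1r.
Qed.

Lemma regular_familyX : regular_family 2 1 (fun j => 0 ^+ j) (fun=> 'X).
Proof.
split=> [z|i|j]; first by rewrite size_polyX.
  pose proof (climM clim_id0 (clim_cst at0 ('X : {poly C})`_i)) as h.
  by rewrite mul0r in h.
apply: clim_eq (climX j clim_id0) _ => z.
by rewrite /moment -['X]expr1 poly_liftXn mul1r.
Qed.

Lemma regular_familyD N1 N2 K1 K2 M1 M2 a (P Q : C -> {poly C}) :
  regular_family N1 K1 M1 P -> regular_family N2 K2 M2 Q ->
  regular_family (maxn N1 N2) (K1 + K2) (fun j => a * M1 j + M2 j)
    (fun z => a *: P z + Q z).
Proof.
move=> [s1 c1 m1] [s2 c2 m2]; split=> [z|i|j].
- rewrite (leq_trans (size_polyD _ _)) // geq_max leq_max.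
  by rewrite (leq_trans (size_scale_leq _ _) (s1 z)) leq_max s2 orbT.
- pose proof (climM (climX K2 clim_id0) (climM (clim_cst at0 a) (c1 i))) as h1.
  pose proof (climM (climX K1 clim_id0) (c2 i)) as h2.
  pose proof (climD h1 h2) as h; rewrite !mulr0 addr0 in h; apply: clim_eq h _ => z.
  by rewrite coefD coefZ exprD; ring.
apply: clim_eq (climD (climM (clim_cst at0 a) (m1 j)) (m2 j)) _ => z.
by rewrite moment_linear.
Qed.

Lemma regular_familyM N1 N2 K1 K2 M1 M2 (P Q : C -> {poly C}) :
  regular_family N1 K1 M1 P -> regular_family N2 K2 M2 Q ->
  regular_family (N1 + N2) (K1 + K2)
    (fun j => \sum_(l < j.+1) 'C(j, l)%:R * (M1 (j - l)%N * M2 l))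
    (fun z => P z * Q z).
Proof.
move=> [s1 c1 m1] [s2 c2 m2]; split=> [z|i|j].
- rewrite (leq_trans (size_polyMleq _ _)) //.
  by rewrite (leq_trans (leq_pred _)) // leq_add.
- pose proof (clim_sum (index_enum 'I_i.+1) (P := xpredT)
    (fun l _ => climM (c1 (l : 'I_i.+1)) (c2 (i - l)%N))) as h.
  rewrite big1 in h => [|l _]; last by rewrite mulr0.
  apply: clim_eq h _ => z; rewrite coefM mulr_sumr.
  by apply: eq_bigr => l _; rewrite exprD mulrACA.
apply: clim_eq (clim_sum (index_enum 'I_j.+1) (P := xpredT)
  (fun l _ => climM (clim_cst at0 'C(j, (l : 'I_j.+1))%:R)
     (climM (m1 (j - l)%N) (m2 l)))) _ => z.
by rewrite momentM.
Qed.

(** Against h n z the sum expands in moments, because h n z is a polynomial in nz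
   of degree K, independent of n, up to o(z^K), and this error meets coefficients
   that are o(z^(-K)). *)
Lemma regular_family_sum N K M (P : C -> {poly C}) (h : nat -> C -> C) (a : nat -> C) :
  regular_family N K M P ->
  (forall n, clim at0 (fun z =>
    (h n z - \sum_(i < K.+1) a i * (n%:R * z) ^+ i) / z ^+ K) 0) ->
  clim at0 (fun z => \sum_(n < N) (P z)`_n * h n z)
    (\sum_(i < K.+1) a i * M i).
Proof.
move=> [sP cP mP] hh.
pose proof (clim_sum (index_enum 'I_K.+1) (P := xpredT)
  (fun i _ => climM (clim_cst at0 (a i)) (mP (i : 'I_K.+1)))) as h1.
pose proof (clim_sum (index_enum 'I_N) (P := xpredT)
  (fun n _ => climM (cP n) (hh (n : 'I_N)))) as h2.
pose proof (climD h1 h2) as h3.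
rewrite [X in clim _ _ (_ + X)]big1 in h3 => [|n _]; last by rewrite mulr0.
rewrite addr0 in h3; apply: clim_near h3 _.
apply: (near_punctured ltr01) => z /andP[z0 _]; rewrite normr_gt0 in z0.
have zK : z ^+ K != 0 by rewrite expf_neq0.
transitivity (\sum_(n < N) (P z)`_n * (\sum_(i < K.+1) a i * (n%:R * z) ^+ i) +
  \sum_(n < N) (P z)`_n * (h n z - \sum_(i < K.+1) a i * (n%:R * z) ^+ i)).
  congr (_ + _); last first.
    by apply: eq_bigr => n _; move: (z ^+ K) zK => t t0; field.
  under [RHS]eq_bigr do rewrite mulr_sumr.
  rewrite exchange_big; apply: eq_bigr => i _ /=.
  rewrite (moment_wide _ _ (sP z)) mulr_sumr; apply: eq_bigr => n _.
  by rewrite mulrCA.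
rewrite -big_split /=; apply: eq_bigr => n _.
by rewrite -mulrDr addrC subrK.
Qed.

End Moments.

(** * Renormalization *)

Section GraftRegular.
Context {R : realType}.
Local Notation C := R[i].
Local Notation at0 := ((0 : C)^').
Implicit Types (z : C) (r : R).
Context {r : R} {c : nat -> C} {G : C -> C}.
Context (r0 : 0 < r) (Gc : laurent 1 c r G).

Let Gps : power_series_on r c (fun z => z * G z).
Proof. exact: (laurentP _ _ _ _).1 Gc. Qed.

Lemma clim_pole j : clim at0 (fun z => z * G (j.+1%:R * z)) (j.+1%:R^-1 * c 0%N).
Proof.
have rj : 0 < r / j.+1%:R by rewrite divr_gt0 // ltr0n.
pose proof (climM (clim_cst at0 (j.+1%:R^-1))
  (clim_power_series0 rj (power_series_scale (ltn0Sn j) Gps))) as h.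
rewrite expr0 mulr1 in h; apply: clim_eq h _ => z.
by rewrite mulrA mulKf // pnatr_eq0.
Qed.

(** The shift from nz to (n+1)z is absorbed by passing to the coefficients of
   X P. *)
Lemma graft_moment j z (P : {poly C}) N : (size P <= N)%N ->
  moment j.+1 z (graft_op (toy_weights G z) P) =
  \sum_(n < N.+1) ('X * P)`_n * ((n%:R * z) ^+ j.+1 * G (n%:R * z)).
Proof.
move=> PN; have PN1 : (size (graft_op (toy_weights G z) P) <= N.+1)%N.
  by rewrite (leq_trans (size_graft_op _ _)).
rewrite (moment_wide _ _ PN1); apply: eq_bigr => -[[|n] nN] _ /=.
  by rewrite coef_graft_op coefXM !mul0r.
by rewrite coef_graft_op coefXM /= /toy_weights -mulrA [G _ * _]mulrC.
Qed.

(** Grafting multiplies the coefficients by values of G, which have a pole at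
   z = 0. In the moments of positive order the factor (nz)^(j+1) compensates it,
   and the moment of order 0 is the value at the subtraction point, which
   vanishes. The limits of the moments do not involve u and v: this is what makes
   the physical limit a function of s/mu. *)
Lemma regular_family_graft N K M : exists M', forall (P : C -> {poly C}) u v,
  regular_family N K M P -> clim at0 u 1 ->
  (forall z, (polyC (v z) + u z *: graft_op (toy_weights G z) (P z)).[1] = 0) ->
  regular_family N.+1 K.+1 M'
    (fun z => polyC (v z) + u z *: graft_op (toy_weights G z) (P z)).
Proof.
(* K' and MX are the pole bound and the limits of the moments of X P; a j lists
   the Taylor coefficients of w^(j+1) G(w) *)
pose K' := (1 + K)%N.
pose MX l := \sum_(i < l.+1) 'C(l, i)%:R * (0 ^+ (l - i) * M i) : C.
pose a j k := if (k < j)%N then 0 else c (k - j)%N.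
exists (fun j => if j is j'.+1 then \sum_(i < K'.+1) a j' i * MX i else 0).
move=> P u v hP u1 Q1; have [sP cP mP] := hP.
set Q := fun z => _ + _ in Q1 *.
have cQS i : clim at0 (fun z => z ^+ K.+1 * (Q z)`_i.+1) 0.
  pose proof (climM u1 (climM (cP i) (clim_pole i))) as h.
  rewrite mul0r mulr0 in h; apply: clim_eq h _ => z.
  by rewrite coefD coefC coefZ coef_graft_op /= add0r exprSr /toy_weights; ring.
have sQ z : (size (Q z) <= N.+1)%N.
  rewrite (leq_trans (size_polyD _ _)) // geq_max (leq_trans (size_polyC_leq1 _)) //.
  rewrite (leq_trans (size_scale_leq _ _)) // (leq_trans (size_graft_op _ _)) //.
  by rewrite ltnS.
split=> // [[|i]|[|j]]; last 1 first.
- have hX := regular_familyM regular_familyX hP.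
  (* at n = 0 the coefficient of X P vanishes, and the value of h is chosen to fit
     its expansion *)
  pose h n z := if n is 0%N then a j 0%N else (n%:R * z) ^+ j.+1 * G (n%:R * z).
  have hh n : clim at0 (fun z =>
      (h n z - \sum_(i < K'.+1) a j i * (n%:R * z) ^+ i) / z ^+ K') 0.
    case: n => [|n].
      apply: clim_eq (clim_cst at0 0) _ => z.
      rewrite big_ord_recl mul0r expr0 mulr1 big1 ?addr0 => [|i _].
        by rewrite subrr mul0r.
      by rewrite expr0n mulr0.
    have rn : 0 < r / n.+1%:R by rewrite divr_gt0 // ltr0n.
    have hs := power_series_scale (ltn0Sn n) (power_seriesX j Gps).
    apply: clim_eq (clim_power_series K' rn hs) _ => z.
    congr ((_ - _) / _); first by rewrite /h exprSr mulrA.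
    by apply: eq_bigr => i _; rewrite exprMn mulrA.
  have hs := regular_family_sum hX hh.
  pose proof (climM u1 hs) as h1; rewrite mul1r in h1.
  apply: clim_eq h1 _ => z.
  have mC : moment j.+1 z (polyC (v z)) = 0.
    rewrite (@moment_wide _ _ _ _ 1) ?size_polyC_leq1 // big_ord1.
    by rewrite mul0r expr0n mulr0.
  have -> : moment j.+1 z (Q z) =
      u z * moment j.+1 z (graft_op (toy_weights G z) (P z)).
    rewrite /Q addrC moment_linear mC addr0.
    by [].
  have sP1 : (size (P z) <= N.+1)%N by rewrite (leq_trans (sP z)).
  rewrite (graft_moment _ _ sP1); congr (_ * _).
  apply: eq_bigr => -[[|n] nN] _ //=; first by rewrite coefXM !mul0r.
(* the constant term is minus the sum of the others since Q vanishes at 1 *)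
- pose proof (climB (clim_cst at0 (0 : C)) (clim_sum (index_enum 'I_N) (P := xpredT)
    (fun i _ => cQS (i : 'I_N)))) as h.
  rewrite sub0r big1 ?oppr0 // in h; apply: clim_eq h _ => z.
  rewrite -mulr_sumr sub0r -mulrN; congr (_ * _).
  have := Q1 z; rewrite -/(Q z) (horner_coef_wide _ (sQ z)) big_ord_recl mulr1.
  move/eqP; rewrite addr_eq0 => /eqP ->; congr (- _).
  by apply: eq_bigr => i _; rewrite expr1n mulr1.
- exact: cQS.
apply: clim_eq (clim_cst at0 0) _ => z.
by rewrite moment0 Q1.
Qed.

(** The test functions are n, z |-> exp(-x(nz)), with Taylor coefficients
   (-x)^i / i!; the truncation at order K makes the limit a polynomial in x. *)
Lemma clim_regular_family N K M (P : C -> {poly C}) (x : R) :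
  regular_family N K M P ->
  clim at0 (fun z => (P z).[cexp (- x%:C * z)])
    (\poly_(i < K.+1) ((-1) ^+ i / i`!%:R * M i)).[x%:C].
Proof.
move=> hP; have [sP _ _] := hP.
have hh n : clim at0 (fun z => (cexp (- x%:C * (n%:R * z)) - \sum_(i < K.+1)
    ((- x%:C) ^+ i / i`!%:R) * (n%:R * z) ^+ i) / z ^+ K) 0.
  case: n => [|n].
    apply: clim_eq (clim_cst at0 0) _ => z; rewrite mul0r mulr0 cexp0.
    rewrite big_ord_recl !expr0 fact0 divr1 mulr1 big1 ?addr0 ?subrr ?mul0r // => i _.
    by rewrite expr0n mulr0.
  have rn : 0 < (1 : R) / n.+1%:R by rewrite divr_gt0 // ltr0n.
  have hs := power_series_scale (ltn0Sn n) (@power_series_cexp R 1 (- x%:C)).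
  apply: clim_eq (clim_power_series K rn hs) _ => z.
  congr ((_ - _) / _); apply: eq_bigr => i _; by rewrite exprMn mulrA.
have h := @regular_family_sum R N K M P (fun n z => cexp (- x%:C * (n%:R * z)))
  (fun i => (- x%:C) ^+ i / i`!%:R) hP hh.
rewrite horner_poly; have -> : \sum_(i < K.+1) (-1) ^+ i / i`!%:R * M i * x%:C ^+ i =
    \sum_(i < K.+1) (- x%:C) ^+ i / i`!%:R * M i.
  by apply: eq_bigr => i _; rewrite [(- x%:C) ^+ i]exprNn; ring.
apply: clim_eq h _ => z; rewrite (horner_coef_wide _ (sP z)).
by apply: eq_bigr => n _; rewrite -cexpMn -mulr_natl; congr (_ * cexp _); ring.
Qed.

End GraftRegular.

Section Renormalization.
Context {R : realType}.
Local Notation C := R[i].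
Local Notation at0 := ((0 : C)^').
Local Notation conv := Defs.conv.
Implicit Types (s mu : R) (z : C) (g : HR C).
Context {f : R -> C} {delta r : R} {G : C -> C}.
Context (hG : mellin_extension f delta r G).

(** Substituting mu^(-z) X for X takes the scale mu as unit, so that X stands for
   (s/mu)^(-z). *)
Definition renormalized_poly mu z g : {poly C} :=
  conv (polyC \o (toy_rules G mu z \o antipode))
    (toy_poly (toy_weights G z)) g \Po (cpow mu (- z) *: 'X).

Lemma counterterms_scalar mu z : scalar (toy_rules G mu z \o antipode).
Proof. by move=> a x y /=; rewrite antipode_linear toy_rules_scalar. Qed.

Lemma renormalized_polyE mu s z g : 0 < s -> 0 < mu ->
  renormalized (toy_rules G) mu s z g =
  (renormalized_poly mu z g).[cpow (s / mu) (- z)].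
Proof.
move=> s0 mu0; rewrite /renormalized_poly horner_comp hornerZ hornerX -cpow_div //.
by rewrite horner_conv.
Qed.

Lemma renormalized_poly_linear mu z : linear (renormalized_poly mu z).
Proof.
by move=> a x y; rewrite /renormalized_poly conv_linear comp_polyD comp_polyZ.
Qed.

Lemma renormalized_poly_morph mu z : monoid_morphism (renormalized_poly mu z).
Proof.
have mZ : monoid_morphism (polyC \o (toy_rules G mu z \o antipode)).
  apply: monoid_morphism_comp; first exact: (conj (polyC1 C) (@polyCM C)).
  exact: monoid_morphism_comp (toy_rules_morph G mu z) (@antipode_morph C).
have [c1 cM] := conv_morph mZ (toy_poly_morph (toy_weights G z)).
split=> [|x y]; rewrite /renormalized_poly ?c1 ?comp_polyC //.
by rewrite cM comp_polyM.
Qed.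

(** At s = mu the counterterms are the convolution inverse of the rules. *)
Lemma renormalized_poly1 mu z g : (renormalized_poly mu z g).[1] = counit g.
Proof.
rewrite /renormalized_poly horner_comp hornerZ hornerX mulr1 horner_conv.
have := @conv_comp_antipode _ _ (toy_rules G mu z) g
  (@toy_rules_scalar _ G mu z) (toy_rules_morph G mu z).
by move=> h; apply: etrans h _; exact: mulr1.
Qed.

Lemma graft_op_comp_scale (w : nat -> C) (P : {poly C}) (u : C) :
  graft_op w P \Po (u *: 'X) = u *: graft_op w (P \Po (u *: 'X)).
Proof.
move: P; apply: poly_linear_ext => [a x y|a x y|n].
- by rewrite linearP comp_polyD comp_polyZ.
- by rewrite comp_polyD comp_polyZ linearP scalerDr !scalerA mulrC.
rewrite comp_Xn_poly exprZn linearZ /= /graft_op !poly_liftXn.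
rewrite comp_polyZ comp_Xn_poly exprZn !scalerA exprS.
by congr (_ *: _); ring.
Qed.

Lemma renormalized_poly_Bplus mu z g :
  renormalized_poly mu z (Bplus g) =
  polyC (toy_rules G mu z (antipode (Bplus g))) +
  cpow mu (- z) *: graft_op (toy_weights G z) (renormalized_poly mu z g).
Proof.
rewrite /renormalized_poly (conv_graft_op _ _ (@counterterms_scalar mu z)).
by rewrite comp_polyD comp_polyC graft_op_comp_scale.
Qed.

Lemma clim_cpow0 mu : clim at0 (fun z => cpow mu (- z)) 1.
Proof.
pose proof (clim_power_series0 ltr01
  (@power_series_cexp R 1 (- (ln mu)%:C))) as h.
rewrite expr0 fact0 divr1 in h; apply: clim_eq h _ => z.
by rewrite cpowE mulrC mulNr mulrN.
Qed.

(** The bounds and the limits of the moments are chosen before mu. *)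
Lemma renormalized_poly_regular g : exists N K M, forall mu, 0 < mu ->
  regular_family N K M (fun z => renormalized_poly mu z g).
Proof.
move: g; apply: HR_ind => [|a x y [N1 [K1 [M1 h1]]] [N2 [K2 [M2 h2]]]|
    x y [N1 [K1 [M1 h1]]] [N2 [K2 [M2 h2]]]|x [N [K [M h]]]].
- do 3 eexists; move=> mu mu0.
  rewrite (_ : (fun z => _) = fun=> 1); first exact: regular_family1.
  by apply/funext => z; rewrite (renormalized_poly_morph mu z).1.
- do 3 eexists; move=> mu mu0.
  rewrite (_ : (fun z => _) = fun z =>
    a *: renormalized_poly mu z x + renormalized_poly mu z y).
    exact: regular_familyD (h1 mu mu0) (h2 mu mu0).
  by apply/funext => z; rewrite renormalized_poly_linear.
- do 3 eexists; move=> mu mu0.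
  rewrite (_ : (fun z => _) = fun z =>
    renormalized_poly mu z x * renormalized_poly mu z y).
    exact: regular_familyM (h1 mu mu0) (h2 mu mu0).
  by apply/funext => z; rewrite (renormalized_poly_morph mu z).2.
have [delta0 r0 [c Gc] _] := hG.
have [M' hM'] := regular_family_graft r0 Gc N K M.
exists N.+1, K.+1, M' => mu mu0.
rewrite (_ : (fun z => _) = fun z =>
    polyC (toy_rules G mu z (antipode (Bplus x))) +
    cpow mu (- z) *: graft_op (toy_weights G z) (renormalized_poly mu z x)).
  apply: hM' (h mu mu0) (clim_cpow0 mu) _ => z.
  by rewrite -renormalized_poly_Bplus renormalized_poly1 counit_Bplus.
by apply/funext => z; exact: renormalized_poly_Bplus.
Qed.

Lemma renormalized_toy_limit g : exists p : {poly C}, forall s mu, 0 < s -> 0 < mu ->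
  clim at0 (fun z => renormalized (toy_rules G) mu s z g) p.[(ln (s / mu))%:C].
Proof.
have [N [K [M h]]] := renormalized_poly_regular g.
eexists => s mu s0 mu0.
apply: clim_eq (clim_regular_family (ln (s / mu)) (h mu mu0)) _ => z.
by rewrite renormalized_polyE // cpowE; congr (_.[cexp _]); ring.
Qed.

(** The coproduct of g involves finitely many pairs of forests, on each of which
   the two families of rules agree near z = 0. *)
Lemma renormalized_near phi s mu g : regularized_rules f phi -> 0 < s -> 0 < mu ->
  \forall z \near at0,
    renormalized (toy_rules G) mu s z g = renormalized phi mu s z g.
Proof.
move=> hphi s0 mu0; rewrite /renormalized /conv /=.
move: (coproduct g) => t; rewrite /tens_mul /basis_lift.
elim: (enum_fset (msupp t)) => [|p l IH].
  by apply: nearW => z; rewrite !big_nil.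
have [r1 r10 h1] := rules_unique hG hphi (antipode << p.1 >>).
have [r2 r20 h2] := rules_unique hG hphi << p.2 >>.
have n1 := near_punctured r10 (fun z zr => h1 mu z mu0 zr).
have n2 := near_punctured r20 (fun z zr => h2 s z s0 zr).
apply: filterS3 n1 n2 IH => z e1 e2 e3.
rewrite !big_cons; congr (_ + _); last exact: e3.
congr (_ *: (_ * _)); last exact: esym e2.
exact: esym e1.
Qed.

End Renormalization.

Theorem proposition3p4p2 (R : realType) (f : R -> R[i]) (hf : admissible f) :
  (exists phi : R -> R[i] -> HR R[i] -> R[i], regularized_rules f phi) /\
  forall phi : R -> R[i] -> HR R[i] -> R[i], regularized_rules f phi ->
  forall g : HR R[i], exists p : {poly R[i]},
  forall s mu : R, 0 < s -> 0 < mu ->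
    renormalized phi mu s z g @[z --> (0 : R[i])^'] --> p.[(ln (s / mu))%:C].
Proof.
have [delta [r [G hG]]] := admissible_mellin_extension hf.
split=> [|phi hphi g]; first by exists (toy_rules G); exact: toy_rules_regularized hG.
have [p hp] := renormalized_toy_limit hG g.
exists p => s mu s0 mu0.
by have [h] := clim_near (hp s mu s0 mu0) (renormalized_near hG g hphi s0 mu0).
Qed.
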